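(* S-equivalence is not a sufficient condition for two links to be related by a sequence of doubled-delta moves. That is, there exist oriented, ordered links $L_0$ and $L_1$ in $S^3$ that are S-equivalent but are not related by any finite sequence of doubled-delta moves.
   Context: Links. A link in $S^3$ is a finite union of disjoint piecewise linear simple closed curves; links are oriented and ordered (components numbered) and considered up to ambient isotopy. A Seifert surface for $L$ is a connected, oriented, compact surface $\Sigma\subset S^3$ with $\partial\Sigma=L$ as oriented links. Given any basis $\{b_i\}$ of $H_1(\Sigma)$, the Seifert matrix $M$ is $M_{i,j}=lk(b_i,b_j^+)$, with $b_j^+$ the pushoff of $b_j$ in the positive normal direction. (Classical) S-equivalence. Two integral square matrices are S-equivalent if one can be transformed into the other by a finite sequence of integral congruences ($V\mapsto A^tVA$ with $A$ integral and $\det A=\pm1$) and of enlargements/reductions, where $W$ is an enlargement of $V$ (and $V$ a reduction of $W$) if $$W=\begin{pmatrix} V & \vec y^{\,t} & 0\\ \vec x & z & 1\\ 0 & 0 & 0\end{pmatrix}\quad\text{or}\quad W=\begin{pmatrix} V & \vec y^{\,t} & 0\\ \vec x & z & 0\\ 0 & 1 & 0\end{pmatrix}$$ for some integral row vectors $\vec x,\vec y$ and integer $z$. Two links are S-equivalent if they have S-equivalent Seifert matrices (Seifert matrices of a given link are well-defined up to S-equivalence). Doubled-delta move. The (single) delta move is the following local move on diagrams. Inside a disk of the projection plane the diagram consists of three arcs, any two of which cross exactly once, the three crossings forming a triangle, such that each arc is the over-strand at one of its two crossings and the under-strand at the other. The move replaces this by the tangle with the same endpoints in which each arc has been moved across the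 crossing of the other two (the triangle is reversed), every pair of arcs still crossing once with the same strand on top. The doubled-delta move is the same with each of the three arcs replaced, in both tangles, by two parallel copies in the projection plane having opposite orientations (each crossing becomes four crossings with the same over/under information). The six strands may belong to any components of the link. The inverse move is also allowed, and components keep their numbering and orientation. *)

(* Defs.v *)
(* Links in S^3 = R^3 U {oo} are represented by polygonal links in R^3, taken
   up to ambient isotopy of R^3. *)
From Stdlib Require Export Relation_Operators.
From mathcomp Require Export all_boot all_order all_algebra.
From mathcomp Require Export all_classical all_reals all_analysis.
Export numFieldNormedType.Exports.
Import Order.TTheory GRing.Theory Num.Theory.

Set Implicit Arguments.
Unset Strict Implicit.
Unset Printing Implicit Defensive.

Local Open Scope classical_set_scope.
Local Open Scope ring_scope.

Definition pt3 (R : realType) (x y z : R) : 'rV[R]_3 :=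
  \row_j [:: x; y; z]`_j.

Definition det3 (R : realType) (u v w : 'rV[R]_3) : R :=
  \det (\matrix_(i < 3) [:: u; v; w]`_i).

(** * Links *)

(* A closed polygon is the list of its vertices; [curve K] is its piecewise
   linear parametrization, periodic of period [size K], reaching the k-th
   vertex at time k. *)
Definition vertex (R : realType) (K : seq 'rV[R]_3) (k : int) : 'rV[R]_3 :=
  K`_(`|(k %% size K)%Z|%N).

Definition curve (R : realType) (K : seq 'rV[R]_3) (t : R) : 'rV[R]_3 :=
  let k := Num.floor t in
  let s := t - k%:~R in
  (1 - s) *: vertex K k + s *: vertex K (k + 1).

(* Each component is a simple closed curve, and the components are disjoint. *)
Definition is_link (R : realType) (n : nat) (L : 'I_n -> seq 'rV[R]_3) : Prop :=
  (forall i, (0 < size (L i))%N) /\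
  (forall (i j : 'I_n) (s t : R),
     0 <= s < (size (L i))%:R -> 0 <= t < (size (L j))%:R ->
     curve (L i) s = curve (L j) t -> i = j /\ s = t).

(* Oriented link with n components, ordered by 'I_n. *)
Record link (R : realType) (n : nat) := Link {
  component :> 'I_n -> seq 'rV[R]_3;
  linkP : is_link component
}.

(* [r] lifts an orientation-preserving homeomorphism of the circle, so that
   [H 1] carries each component onto the component with the same number,
   respecting the orientations. *)
Definition isotopic (R : realType) (n : nat) (L L' : link R n) : Prop :=
  exists H : R -> 'rV[R]_3 -> 'rV[R]_3,
  [/\ {within [set tx : R * 'rV[R]_3 | 0 <= tx.1 <= 1],
         continuous (fun tx : R * 'rV[R]_3 => H tx.1 tx.2)},
      (forall t : R, 0 <= t <= 1 ->
         exists2 G : 'rV[R]_3 -> 'rV[R]_3,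
           continuous G & cancel (H t) G /\ cancel G (H t)),
      (forall x, H 0 x = x)
    & forall i : 'I_n, exists r : R -> R,
        [/\ continuous r, {homo r : s t / s < t},
            (forall t, r (t + (size (L i))%:R) = r t + (size (L' i))%:R)
          & forall t, H 1 (curve (L i) t) = curve (L' i) (r t)]].

(** * Linking numbers *)

(* Given vertices placed in R^3 as the rows of [P], an integer matrix [c] that
   is antisymmetric stands for the 1-chain \sum_(x < x') c x x' [P_x, P_x']. *)

(* Both chains are seen from above, [v] pointing towards the viewer; the
   projection is regular when no vertex of one chain is projected onto an edge
   of the other. *)
Definition regular_direction (R : realType) (N N' : nat)
    (P : 'M[R]_(N, 3)) (c : 'M[int]_N) (Q : 'M[R]_(N', 3)) (d : 'M[int]_N')
    (v : 'rV[R]_3) : Prop :=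
  v != 0 /\
  forall x x' y y', c x x' != 0 -> d y y' != 0 ->
  forall s h : R, 0 <= s <= 1 ->
    row x P != (1 - s) *: row y Q + s *: row y' Q + h *: v /\
    row y Q != (1 - s) *: row x P + s *: row x' P + h *: v.

(* The sign of the crossing where the edge [p, p'] passes over [q, q'], and 0
   if there is no such crossing. *)
Definition over_crossing (R : realType) (v p p' q q' : 'rV[R]_3) : int :=
  if `[< exists s t h : R, [/\ 0 < s < 1, 0 < t < 1, 0 < h
           & (1 - s) *: p + s *: p' = (1 - t) *: q + t *: q' + h *: v] >]
  then sgz (det3 (p' - p) (q' - q) v) else 0.

(* lk(c, d) = k, for disjoint 1-cycles [c] and [d] *)
Definition linking (R : realType) (N N' : nat)
    (P : 'M[R]_(N, 3)) (c : 'M[int]_N) (Q : 'M[R]_(N', 3)) (d : 'M[int]_N')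
    (k : int) : Prop :=
  exists2 v : 'rV[R]_3, regular_direction P c Q d v &
  k = \sum_(x < N) \sum_(x' < N | (x < x')%N)
      \sum_(y < N') \sum_(y' < N' | (y < y')%N)
        c x x' * d y y' *
        over_crossing v (row x P) (row x' P) (row y Q) (row y' Q).

(** * Triangulated oriented surfaces in R^3 *)

(* A triangle is an ordered triple of vertices, the order giving its
   orientation; a triangulation lists each triangle once, in one of its three
   equivalent orders. *)
Definition triangle (N : nat) := ('I_N * 'I_N * 'I_N)%type.

Definition corners (N : nat) (f : triangle N) : seq 'I_N :=
  [:: f.1.1; f.1.2; f.2].

Definition sides (N : nat) (f : triangle N) : seq ('I_N * 'I_N) :=
  [:: (f.1.1, f.1.2); (f.1.2, f.2); (f.2, f.1.1)].

Definition opp_edge (N : nat) (e : 'I_N * 'I_N) : 'I_N * 'I_N := (e.2, e.1).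

Definition adjacent (N : nat) (F : {set triangle N}) : rel (triangle N) :=
  [rel f g | [&& f \in F, g \in F & has (fun e => opp_edge e \in sides g) (sides f)]].

(* The last condition says that the link of each vertex is connected; as an edge
   lies on at most two triangles, it is then a path or a cycle. *)
Definition oriented_surface (N : nat) (F : {set triangle N}) : Prop :=
  [/\ (forall f, f \in F -> uniq (corners f)),
      (forall f g, f \in F -> g \in F -> corners f =i corners g -> f = g),
      (forall f g (e : 'I_N * 'I_N), f \in F -> g \in F ->
         e \in sides f -> e \in sides g -> f = g)
    & (forall (x : 'I_N) f g, f \in F -> g \in F ->
         x \in corners f -> x \in corners g ->
         connect [rel f g | [&& adjacent F f g, x \in corners f & x \in corners g]] f g)].

Definition connected_surface (N : nat) (F : {set triangle N}) : Prop :=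
  F != finset.set0 /\ forall f g, f \in F -> g \in F -> connect (adjacent F) f g.

Definition boundary_edge (N : nat) (F : {set triangle N}) (e : 'I_N * 'I_N) : Prop :=
  (exists2 f, f \in F & e \in sides f) /\
  (forall f, f \in F -> opp_edge e \notin sides f).

(* Geometric realization, in barycentric coordinates. Placing the vertices at
   the rows of [P] sends the point [l] of the realization to [l *m P]. *)
Definition realization (R : realType) (N : nat) (F : {set triangle N}) :
    set 'rV[R]_N :=
  [set l | [/\ forall x : 'I_N, 0 <= l 0 x, \sum_x l 0 x = 1
             & exists2 f, f \in F & forall x : 'I_N, l 0 x != 0 -> x \in corners f]].

Definition embedded (R : realType) (N : nat) (P : 'M[R]_(N, 3))
    (F : {set triangle N}) : Prop :=
  forall l m, realization F l -> realization F m -> l *m P = m *m P -> l = m.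

(* The boundary of the surface, with its induced orientation, is L. *)
Definition has_boundary (R : realType) (n N : nat) (P : 'M[R]_(N, 3))
    (F : {set triangle N}) (L : link R n) : Prop :=
  forall p q : 'rV[R]_3,
    (exists e, [/\ boundary_edge F e, row e.1 P = p & row e.2 P = q]) <->
    (exists i k, vertex (L i) k = p /\ vertex (L i) (k + 1) = q).

Definition seifert_surface (R : realType) (n N : nat) (P : 'M[R]_(N, 3))
    (F : {set triangle N}) (L : link R n) : Prop :=
  [/\ oriented_surface F, connected_surface F, embedded P F & has_boundary P F L].

(** * First homology and Seifert matrices *)

Definition is_cycle (N : nat) (F : {set triangle N}) (c : 'M[int]_N) : Prop :=
  [/\ forall x y, c y x = - c x y,
      forall x y, c x y != 0 ->
        exists2 f, f \in F & (x \in corners f) && (y \in corners f)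
    & forall x, \sum_y c x y = 0].

Definition triangle_boundary (N : nat) (f : triangle N) : 'M[int]_N :=
  \sum_(e <- sides f) (delta_mx e.1 e.2 - delta_mx e.2 e.1).

Definition homologous (N : nat) (F : {set triangle N}) (c d : 'M[int]_N) : Prop :=
  exists a : triangle N -> int, c - d = \sum_(f in F) a f *: triangle_boundary f.

Definition H1_basis (N m : nat) (F : {set triangle N})
    (b : 'I_m -> 'M[int]_N) : Prop :=
  (forall i, is_cycle F (b i)) /\
  (forall c, is_cycle F c ->
     exists! a : 'rV[int]_m, homologous F c (\sum_i a 0 i *: b i)).

(* [phi] pushes the surface off itself, each triangle leaving towards the side
   of its positive normal; at time 1 the push-off is linear on each triangle, so
   that the push-off of a simplicial cycle [c] is [c] with vertices at [Q]. *)
Definition positive_pushoff (R : realType) (N : nat) (P : 'M[R]_(N, 3))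
    (F : {set triangle N}) (Q : 'M[R]_(N, 3)) : Prop :=
  exists phi : R -> 'rV[R]_N -> 'rV[R]_3,
  [/\ {within [set tl : R * 'rV[R]_N | 0 <= tl.1 <= 1 /\ realization F tl.2],
         continuous (fun tl : R * 'rV[R]_N => phi tl.1 tl.2)},
      (forall l, realization F l -> phi 0 l = l *m P /\ phi 1 l = l *m Q),
      (forall (t : R) l m, 0 < t <= 1 -> realization F l -> realization F m ->
         phi t l != m *m P)
    & (forall f l, f \in F -> realization F l ->
         (forall x : 'I_N, x \in corners f -> 0 < l 0 x) ->
         \forall t \near 0^'+,
           0 < det3 (row f.1.2 P - row f.1.1 P) (row f.2 P - row f.1.1 P)
                    (phi t l - l *m P))].

(* [V] is a Seifert matrix of L, for some Seifert surface of a representative of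
   the isotopy class of L and some basis of its first homology. *)
Definition seifert_matrix (R : realType) (n m : nat) (L : link R n)
    (V : 'M[int]_m) : Prop :=
  exists (L' : link R n) (N : nat) (P Q : 'M[R]_(N, 3)) (F : {set triangle N})
         (b : 'I_m -> 'M[int]_N),
  [/\ isotopic L L', seifert_surface P F L', H1_basis F b, positive_pushoff P F Q
    & forall i j, linking P (b i) Q (b j) (V i j)].

(** * S-equivalence *)

Definition enlargement_col (m : nat) (V : 'M[int]_m) (x y : 'rV[int]_m) (z : int) :
    'M[int]_(m + 1 + 1) :=
  block_mx (block_mx V y^T x z%:M) (col_mx 0 1%:M) 0 0.

Definition enlargement_row (m : nat) (V : 'M[int]_m) (x y : 'rV[int]_m) (z : int) :
    'M[int]_(m + 1 + 1) :=
  block_mx (block_mx V y^T x z%:M) 0 (row_mx 0 1%:M) 0.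

Inductive S_equivalent : forall m m' : nat, 'M[int]_m -> 'M[int]_m' -> Prop :=
| S_congruence m (V A : 'M[int]_m) :
    \det A = 1 \/ \det A = -1 -> S_equivalent V (A^T *m V *m A)
| S_enlargement_col m (V : 'M[int]_m) x y z :
    S_equivalent V (enlargement_col V x y z)
| S_enlargement_row m (V : 'M[int]_m) x y z :
    S_equivalent V (enlargement_row V x y z)
| S_refl m (V : 'M[int]_m) : S_equivalent V V
| S_sym m m' (V : 'M[int]_m) (W : 'M[int]_m') :
    S_equivalent V W -> S_equivalent W V
| S_trans m m' m'' (V : 'M[int]_m) (W : 'M[int]_m') (X : 'M[int]_m'') :
    S_equivalent V W -> S_equivalent W X -> S_equivalent V X.

Definition S_equivalent_links (R : realType) (n n' : nat)
    (L : link R n) (L' : link R n') : Prop :=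
  exists (m m' : nat) (V : 'M[int]_m) (V' : 'M[int]_m'),
    [/\ seifert_matrix L V, seifert_matrix L' V' & S_equivalent V V'].

(** * Doubled-delta moves *)

(* The disk of the projection plane is the hexagon |x|, |y|, |x - y| <= 12,
   invariant under the linear map (x, y) |-> (- y, x - y), which has order 3
   (a rotation by 120 degrees in suitable coordinates). *)
Definition over_disk (R : realType) : set 'rV[R]_3 :=
  [set p | [/\ `|p 0 0| <= 12, `|p 0 1| <= 12 & `|p 0 0 - p 0 1| <= 12]].

Definition turn (R : realType) (p : 'rV[R]_3) : 'rV[R]_3 :=
  pt3 (- p 0 1) (p 0 0 - p 0 1) (p 0 (2 : 'I_3)).

(* The tangle of six strands: arc k (k : 'I_3) is the k-th turn of arc 0, which
   runs between the opposite sides x = -12 and x = 12 of the hexagon, and [e]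
   selects one of its two parallel copies, (0, 2, 0) apart. The strands of arc 0
   follow y = x/2 + 2s +- 1 for -8 <= x <= 8, where all their crossings lie: for
   s = 1 they cross arc 1 at x < 0 and arc 2 at x > 0, while for s = -1 the order,
   and so the triangle, is reversed. In both tangles arc k is over arc k + 1 if
   h = 1, and under it if h = -1. The endpoints do not depend on s. *)
Definition strand (R : realType) (s h : R) (k : 'I_3) (e : bool) : seq 'rV[R]_3 :=
  let u : R := (-1) ^+ e in
  [seq iter k (@turn R) p | p <-
     [:: pt3 (- 12) (- 6 + u) 0;
         pt3 (- 8) (- 4 + 2 * s + u) (s * h);
         pt3 8 (4 + 2 * s + u) (- (s * h));
         pt3 12 (6 + u) 0]].

(* Up to isotopy, L' is obtained from L by the move with crossing pattern h.
   Strand (k, e) is traversed by component [c k e] of L, starting at its vertex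
   [a k e]; it is traversed forward or backward, the two copies of an arc in
   opposite directions. Within the region above and below the disk L consists of
   the six strands only, and outside of it L and L' agree. *)
Definition doubled_delta (R : realType) (n : nat) (L L' : link R n) : Prop :=
  exists (h : R) (c : 'I_3 -> bool -> 'I_n) (a : 'I_3 -> bool -> int)
         (o : 'I_3 -> bool),
  let dir k e : int := (-1) ^+ (o k (+) e) in
  [/\ h = 1 \/ h = -1,
      (forall k e (j : 'I_4),
         vertex (L (c k e)) (a k e + dir k e * j%:Z) = (strand 1 h k e)`_j /\
         vertex (L' (c k e)) (a k e + dir k e * j%:Z) = (strand (-1) h k e)`_j),
      (forall i (t : R), over_disk (curve (L i) t) ->
         exists k e (s : R), 0 <= s <= 3 /\
           curve (L i) t = curve (L (c k e)) ((a k e)%:~R + (dir k e)%:~R * s)),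
      (forall i, size (L' i) = size (L i))
    & (forall i k, ~ over_disk (vertex (L i) k) ->
         vertex (L' i) k = vertex (L i) k)].

Definition doubled_delta_related (R : realType) (n : nat) : link R n -> link R n -> Prop :=
  clos_refl_sym_trans (link R n) (fun L L' => isotopic L L' \/ doubled_delta L L').

(* Main.v *)
(** The same surface with two numberings of its boundary gives S-equivalent links,
    since a Seifert matrix does not see the numbering. On the other hand the moves
    preserve the linking number of the components numbered 0 and 1. A surface with
    boundary a Hopf link and a third, unlinked, curve, namely a Hopf annulus with a
    hole in one of its faces, therefore gives two S-equivalent links that are not
    related by the moves.

    The parity of the linking number is detected as the degree mod 2 of the map
    (s, t) |-> K(s) - K'(t) from the torus to the nonzero vectors: as in Sperner's
    lemma, it is the parity of the number of triangles of a fine subdivision of the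
    torus carrying three given labels, and a homotopy through nonvanishing maps
    does not change it. An isotopy provides such a homotopy. For a doubled-delta
    move the segment between the two difference maps does, after adding a vertical
    bump on the pairs of crossing strands, which keeps their heights apart while
    they pass over each other; the bump need not come from a motion of the link. *)
From Stdlib Require Import BinInt.
Require Import Defs.
From mathcomp Require Import zify ssrZ ring lra.
Import Order.TTheory GRing.Theory Num.Theory.

Set Implicit Arguments.
Unset Strict Implicit.
Unset Printing Implicit Defensive.

Local Open Scope classical_set_scope.
Local Open Scope ring_scope.

(** * Counting full triangles on a torus *)

Section Sperner.
Local Open Scope nat_scope.

(** Crossings cannot simply be followed along an isotopy: [isotopic] gives only a continuous family
    of homeomorphisms, under which polygons need not stay polygonal or have regular projections. A
    degree asks only for continuity and nonvanishing, and mod 2 it needs no signs; this is enough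
    because the linking numbers to be told apart are 0 and, up to sign, 1. The third component is
    essential: lk(K, K') = lk(K', K), so renumbering a two-component link would go unnoticed. For
    the move, the obstacle is that the middle part of a strand has height -s h x / 8, with s going
    from 1 to -1, so that straight interpolation flattens the tangle halfway and lets crossing
    strands meet. Each arc being over the next is a cyclic pattern, which no assignment of one
    height to each arc can realize. A difference map can instead be corrected separately for each
    pair of points. *)

Definition full_triangle (a b c : nat) : bool :=
  perm_eq [:: a; b; c] [:: 1; 2; 3].

Definition all_four (s : seq nat) : bool :=
  [&& 0 \in s, 1 \in s, 2 \in s & 3 \in s].

(** If label 0 is missing, the number of faces labelled 1, 2, 3 is zero or two; if one of 1, 2, 3 is
    missing, there is no such face. *)
Lemma tetrahedron_parity (a b c d : nat) :
  a < 4 -> b < 4 -> c < 4 -> d < 4 -> ~~ all_four [:: a; b; c; d] ->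
  full_triangle a b c (+) full_triangle b c d =
  full_triangle a b d (+) full_triangle a c d.
Proof.
by case: a => [|[|[|[|a]]]] // _; case: b => [|[|[|[|b]]]] // _;
   case: c => [|[|[|[|c]]]] // _; case: d => [|[|[|[|d]]]].
Qed.

(* The unit square with corners labelled a, b, c, d, with a and d opposite, is
   cut along its diagonal ad. *)
Definition square (a b c d : nat) : bool :=
  full_triangle a b d (+) full_triangle a c d.

Lemma all_four_sub (s t : seq nat) :
  {subset s <= t} -> ~~ all_four t -> ~~ all_four s.
Proof.
by move=> st; apply: contra => /and4P[? ? ? ?]; apply/and4P; split; exact: st.
Qed.

(** Six tetrahedra around the diagonal from [a] to [xyz], one for each order of the three axes, fill
    the cube, and their inner faces cancel. They cut each face of the cube along the diagonal used
    by [square], in agreement with the neighbouring cubes. *)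
Lemma cube_parity (a x y z xy xz yz xyz : nat) :
  all (fun k => k < 4) [:: a; x; y; z; xy; xz; yz; xyz] ->
  ~~ all_four [:: a; x; y; z; xy; xz; yz; xyz] ->
  square a x y xy (+) square z xz yz xyz =
  (square a x z xz (+) square y xy yz xyz) (+)
  (square a y z yz (+) square x xy xz xyz).
Proof.
move=> /and5P[la lx ly lz /and5P[lxy lxz lyz lxyz _]] H.
have sub (s : seq nat) : all [in [:: a; x; y; z; xy; xz; yz; xyz]] s -> ~~ all_four s.
  by move=> /allP sI; exact: all_four_sub H.
have t1 := tetrahedron_parity la lx lxy lxyz
  (sub [:: a; x; xy; xyz] ltac:(by rewrite /= !inE !eqxx !orbT)).
have t2 := tetrahedron_parity la lx lxz lxyz
  (sub [:: a; x; xz; xyz] ltac:(by rewrite /= !inE !eqxx !orbT)).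
have t3 := tetrahedron_parity la ly lxy lxyz
  (sub [:: a; y; xy; xyz] ltac:(by rewrite /= !inE !eqxx !orbT)).
have t4 := tetrahedron_parity la ly lyz lxyz
  (sub [:: a; y; yz; xyz] ltac:(by rewrite /= !inE !eqxx !orbT)).
have t5 := tetrahedron_parity la lz lxz lxyz
  (sub [:: a; z; xz; xyz] ltac:(by rewrite /= !inE !eqxx !orbT)).
have t6 := tetrahedron_parity la lz lyz lxyz
  (sub [:: a; z; yz; xyz] ltac:(by rewrite /= !inE !eqxx !orbT)).
rewrite /square.
have bb (p q r : bool) : (p (+) q = r) -> p = r (+) q by move=> <-; rewrite addbK.
rewrite (bb _ _ _ t1) (bb _ _ _ t2) (bb _ _ _ t3) (bb _ _ _ t4) (bb _ _ _ t5) (bb _ _ _ t6).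
move: (full_triangle x xy xyz) (full_triangle x xz xyz) (full_triangle y xy xyz)
  (full_triangle y yz xyz) (full_triangle z xz xyz) (full_triangle z yz xyz)
  (full_triangle a x xyz) (full_triangle a y xyz) (full_triangle a z xyz)
  (full_triangle a xy xyz) (full_triangle a xz xyz) (full_triangle a yz xyz).
by do 12! case.
Qed.

Definition layer_count (n : nat) (l : nat -> nat -> nat) : bool :=
  \big[addb/false]_(0 <= i < n) \big[addb/false]_(0 <= j < n)
    square (l i j) (l i.+1 j) (l i j.+1) (l i.+1 j.+1).

Lemma big_addb_telescope n (h : nat -> bool) :
  h n = h 0 -> \big[addb/false]_(0 <= i < n) (h i (+) h i.+1) = false.
Proof.
move=> e; suff -> : \big[addb/false]_(0 <= i < n) (h i (+) h i.+1) = h 0 (+) h n.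
  by rewrite e addbb.
elim: n {e} => [|n IH]; first by rewrite big_nil addbb.
by rewrite big_nat_recr //= IH addbA -[_ (+) _ (+) h n]addbA addbb addbF.
Qed.

(** When the parities of the cubes between two layers are added, the lateral faces telescope and
    cancel by periodicity, which leaves only the two layers. *)
Lemma layer_countS (n : nat) (l : nat -> nat -> nat -> nat) (k : nat) :
  (forall i j, l k n j = l k 0 j /\ l k.+1 n j = l k.+1 0 j /\
               l k i n = l k i 0 /\ l k.+1 i n = l k.+1 i 0) ->
  (forall k i j, l k i j < 4) ->
  (forall i j, i < n -> j < n ->
     ~~ all_four [:: l k i j; l k i.+1 j; l k i j.+1; l k.+1 i j; l k i.+1 j.+1;
                     l k.+1 i.+1 j; l k.+1 i j.+1; l k.+1 i.+1 j.+1]) ->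
  layer_count n (l k) = layer_count n (l k.+1).
Proof.
move=> per lt4 nf.
suff : layer_count n (l k) (+) layer_count n (l k.+1) = false.
  by case: (layer_count n (l k)); case: (layer_count n (l k.+1)).
rewrite /layer_count -big_split /=.
under eq_big_nat => i /andP[_ ni].
  rewrite -big_split /=.
  under eq_big_nat => j /andP[_ nj].
    rewrite (cube_parity _ (nf i j ni nj)) ?/= ?lt4 //.
    over.
  rewrite big_split /= big_addb_telescope ?addFb; last first.
    by have [_ [_ [-> ->]]] := per i 0; have [_ [_ [-> ->]]] := per i.+1 0.
  over.
rewrite exchange_big /= big1 // => j _.
rewrite big_addb_telescope //.
by have [-> [-> _]] := per 0 j; have [-> [-> _]] := per 0 j.+1.
Qed.

End Sperner.

(* Only the origin is adherent to the four regions, so that the values of a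
   nonvanishing map on a small simplex miss a label; a triangle with the labels
   1, 2, 3 sits where the map crosses the positive z-axis. *)
Definition label (R : realType) (v : 'rV[R]_3) : nat :=
  if v 0 (2 : 'I_3) <= 0 then 0%N else if 0 < v 0 0 then 1%N
  else if 0 < v 0 1 then 2%N else 3%N.

Definition degree_mod2 (R : realType) (n : nat) (g : R -> R -> 'rV[R]_3) : bool :=
  layer_count n (fun i j => label (g (i%:R / n%:R) (j%:R / n%:R))).

(** The count is meaningful only on grids that are fine enough for the map at hand, so maps are
    compared on all sufficiently fine grids and no limit is taken. *)
Definition same_degree (R : realType) (g g' : R -> R -> 'rV[R]_3) : Prop :=
  exists M, forall n, (M <= n)%N -> degree_mod2 n g = degree_mod2 n g'.

Lemma same_degree_sym (R : realType) (g g' : R -> R -> 'rV[R]_3) :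
  same_degree g g' -> same_degree g' g.
Proof. by case=> M H; exists M => n /H. Qed.

Lemma same_degree_trans (R : realType) (g1 g2 g3 : R -> R -> 'rV[R]_3) :
  same_degree g1 g2 -> same_degree g2 g3 -> same_degree g1 g3.
Proof.
case=> M H [M' H']; exists (maxn M M') => n; rewrite geq_max => /andP[Mn M'n].
by rewrite H // H'.
Qed.

Lemma ord3 (k : 'I_3) : k = 0 \/ k = 1 \/ k = 2.
Proof.
by case: k => [[|[|[|k]]] i] //; [left|right; left|right; right]; apply/val_inj.
Qed.

Lemma label_lt4 (R : realType) (v : 'rV[R]_3) : (label v < 4)%N.
Proof. by rewrite /label; do 3 case: ifP => // _. Qed.

Lemma label_coord_pos (R : realType) (v : 'rV[R]_3) (c : 'I_3) :
  0 < v 0 c -> label v != nth 0%N [:: 3; 3; 0]%N c.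
Proof.
by case: (ord3 c) => [->|[->|->]] H; rewrite /label; do 3? case: ifP => //=; lra.
Qed.

Lemma label_coord_neg (R : realType) (v : 'rV[R]_3) (c : 'I_3) :
  v 0 c < 0 -> label v != nth 0%N [:: 1; 2; 1]%N c.
Proof.
by case: (ord3 c) => [->|[->|->]] H; rewrite /label; do 3? case: ifP => //=; lra.
Qed.

Definition constant_sign (R : realType) (T : Type) (A : set T) (F : T -> 'rV[R]_3) : Prop :=
  exists c : 'I_3, (forall q, A q -> 0 < F q 0 c) \/ (forall q, A q -> F q 0 c < 0).

(** Each open half-space bounded by a coordinate plane misses one of the four regions: the positive
    sides of x, y, z miss the labels 3, 3, 0 and the negative sides 1, 2, 1. *)
Lemma constant_sign_labels (R : realType) (T : Type) (A : set T)
    (F : T -> 'rV[R]_3) (s : seq T) :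
  constant_sign A F -> (forall q, List.In q s -> A q) ->
  ~~ all_four [seq label (F q) | q <- s].
Proof.
case=> c H sA.
have [m m4 Hm] : exists2 m, (m < 4)%N & forall q, List.In q s -> label (F q) != m.
  case: H => H.
  - exists (nth 0%N [:: 3; 3; 0]%N c); first by case: c {H} => [[|[|[|c]]]].
    by move=> q qs; apply: label_coord_pos; apply/H/sA.
  - exists (nth 0%N [:: 1; 2; 1]%N c); first by case: c {H} => [[|[|[|c]]]].
    by move=> q qs; apply: label_coord_neg; apply/H/sA.
have : m \notin [seq label (F q) | q <- s].
  elim: s {sA} Hm => //= q s IH Hm; rewrite inE negb_or eq_sym Hm /=; last by left.
  by apply: IH => q' q's; apply: Hm; right.
apply: contra => /and4P[].
by case: m m4 {Hm} => [|[|[|[|m]]]].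
Qed.

(** A Lebesgue number argument: near each point some coordinate of [F] is nonzero and keeps its
    sign, and compactness makes the radius uniform. *)
Lemma constant_sign_near (R : realType) (F : R * R * R -> 'rV[R]_3)
    (K : set (R * R * R)) :
  continuous F -> (forall p, F p != 0) -> compact K ->
  \forall n \near \oo, forall p, K p -> constant_sign (ball p (2 / n.+1%:R)) F.
Proof.
move=> cF F0 /compact_near_coveringP cK; apply: cK => p _.
have [c Fc] : exists c, F p 0 c != 0.
  apply/existsP; move: (F0 p); apply: contraR; rewrite negb_exists => /forallP H.
  by apply/eqP/rowP => c; rewrite mxE; apply/eqP; move: (H c); rewrite negbK.
have cFc : continuous (fun q => F q 0 c).
  move=> q; apply: (@continuous_comp _ _ _ F (fun M : 'rV[R]_3 => M 0 c)); first exact: cF.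
  exact: coord_continuous.
have key (P : R -> Prop) (oP : open P) : P (F p 0 c) ->
    \forall p' \near p & n \near \oo,
      forall q, ball p' (2 / n.+1%:R) q -> P (F q 0 c).
  move=> Pp.
  have : nbhs p (fun q => P (F q 0 c)) by apply: cFc; exact: open_nbhs_nbhs.
  move=> /nbhs_ballP[e /= e0 eP].
  have e4 : 0 < e / 4 by rewrite divr_gt0.
  near=> p' n => q p'q; apply: eP.
  rewrite (splitr e); apply: (@ball_triangle _ _ p').
    by near: p'; apply: nbhsx_ballx; rewrite divr_gt0.
  apply: le_ball p'q.
  have : n.+1%:R^-1 < e / 4 by near: n; exact: (near_infty_natSinv_lt (PosNum e4)).
  by move: (n.+1%:R^-1) => z; lra.
have [Fpos|Fneg|/eqP] := ltgtP 0 (F p 0 c); last by rewrite eq_sym (negbTE Fc).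
- have := key (fun x => 0 < x) (@open_gt _ 0) Fpos.
  by apply: filterS => -[p' n] /= H; exists c; left.
- have := key (fun x => x < 0) (@open_lt _ 0) Fneg.
  by apply: filterS => -[p' n] /= H; exists c; right.
Unshelve. all: end_near. Qed.

Lemma homotopy_same_degree (R : realType) (F : R * R * R -> 'rV[R]_3) :
  continuous F -> (forall p, F p != 0) ->
  (forall t a b, F (t, a + 1, b) = F (t, a, b) /\ F (t, a, b + 1) = F (t, a, b)) ->
  same_degree (fun a b => F (0, a, b)) (fun a b => F (1, a, b)).
Proof.
move=> cF F0 per.
have cK : compact (`[0, 1] `*` `[0, 1] `*` `[0, 1] : set (R * R * R)).
  by apply: compact_setX; [apply: compact_setX|]; exact: segment_compact.
have [M _ HM] := constant_sign_near cF F0 cK.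
exists M.+1 => -[//|n] Mn.
have {HM} HM := HM n Mn.
pose l k i j := label (F (k%:R / n.+1%:R, i%:R / n.+1%:R, j%:R / n.+1%:R)).
have n0 : n.+1%:R != 0 :> R by rewrite pnatr_eq0.
(* Time is cut as finely as the torus, so that consecutive layers bound cubes of side 1 / (n + 1),
   each inside a ball of radius 2 / (n + 1) on which a label is missing. *)
suff H k : (k <= n.+1)%N -> layer_count n.+1 (l 0%N) = layer_count n.+1 (l k).
  have := H n.+1 (leqnn _).
  rewrite /degree_mod2 /l; congr (layer_count _ _ = layer_count _ _);
    by apply/funext => i; apply/funext => j; rewrite ?mul0r ?divff.
elim: k => // k IH kn; rewrite {}IH ?(ltnW kn) //; apply: layer_countS.
- move=> i j; rewrite /l divff // mul0r -[1]add0r.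
  split; first by rewrite (per _ 0 _).1.
  split; first by rewrite (per _ 0 _).1.
  split; first by rewrite (per _ _ 0).2.
  by rewrite (per _ _ 0).2.
- by move=> *; exact: label_lt4.
- move=> i j ni nj.
  pose q k i j : R * R * R := (k%:R / n.+1%:R, i%:R / n.+1%:R, j%:R / n.+1%:R).
  apply: (@constant_sign_labels _ _ _ F [:: q k i j; q k i.+1 j; q k i j.+1;
    q k.+1 i j; q k i.+1 j.+1; q k.+1 i.+1 j; q k.+1 i j.+1; q k.+1 i.+1 j.+1]).
    apply: (HM (q k i j)); rewrite /q /=.
    have unit m : (m < n.+1)%N -> m%:R / n.+1%:R \in `[0, 1 : R].
      by move=> mn; rewrite in_itv /= divr_ge0 //= ler_pdivrMr // mul1r ler_nat ltnW.
    by split; [split|]; apply: unit.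
  have b0 m : ball (m%:R / n.+1%:R : R) (2 / n.+1%:R) (m%:R / n.+1%:R).
    by apply: ballxx; rewrite divr_gt0.
  have b1 m : ball (m%:R / n.+1%:R : R) (2 / n.+1%:R) (m.+1%:R / n.+1%:R).
    rewrite /ball /= -mulrBl -[m.+1]addn1 natrD opprD addrA subrr add0r mulN1r normrN.
    by rewrite gtr0_norm ?invr_gt0 // ltr_pMl ?invr_gt0 ?ltr1n.
  move=> r /= H.
  by do 8? [case: H => [<-|H]; first by split; [split|]; rewrite /=; first [exact: b0|exact: b1]].
Qed.

(** * Differences of closed polygons *)

Section Continuity.
Variables (T U V : topologicalType).
Lemma continuous_pair (f : T -> U) (g : T -> V) :
  continuous f -> continuous g -> continuous (fun x => (f x, g x)).
Proof. by move=> cf cg x; exact: (cvg_pair (cf x) (cg x)). Qed.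
Lemma continuous_compose (f : T -> U) (g : U -> V) :
  continuous f -> continuous g -> continuous (fun x => g (f x)).
Proof. by move=> cf cg x; exact: (cvg_comp _ _ (cf x) (cg _)). Qed.
Lemma continuous_identity : continuous (fun x : T => x).
Proof. by move=> x; exact: cvg_id. Qed.
Lemma continuous_fst : continuous (fun p : T * U => p.1).
Proof. by move=> p; exact: cvg_fst. Qed.
Lemma continuous_snd : continuous (fun p : T * U => p.2).
Proof. by move=> p; exact: cvg_snd. Qed.
End Continuity.
Section NormedContinuity.
Variables (T : topologicalType) (R : realType) (V : normedModType R).
Lemma continuous_cst (v : V) : continuous (fun _ : T => v).
Proof. by move=> x; exact: cvg_cst. Qed.
Lemma continuous_add (f g : T -> V) : continuous f -> continuous g -> continuous (fun x => f x + g x).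
Proof. by move=> cf cg x; exact: (cvgD (cf x) (cg x)). Qed.
Lemma continuous_sub (f g : T -> V) : continuous f -> continuous g -> continuous (fun x => f x - g x).
Proof. by move=> cf cg x; exact: (cvgB (cf x) (cg x)). Qed.
Lemma continuous_scale (f : T -> R) (g : T -> V) : continuous f -> continuous g -> continuous (fun x => f x *: g x).
Proof. by move=> cf cg x; exact: (cvgZ (cf x) (cg x)). Qed.
Lemma continuous_mul (f g : T -> R) : continuous f -> continuous g -> continuous (fun x => f x * g x).
Proof. by move=> cf cg x; exact: (cvgM (cf x) (cg x)). Qed.
Lemma continuous_normr (f : T -> R) : continuous f -> continuous (fun x => `|f x|).
Proof. by move=> cf x; exact: (cvg_norm (cf x)). Qed.
End NormedContinuity.

Ltac solve_continuity :=
  match goal with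
  | |- continuous (fun _ => ?c) => exact: continuous_cst
  | |- continuous (fun x => x) => exact: continuous_identity
  | H : continuous ?f |- continuous ?f => exact: H
  | |- continuous (fun x => fst x) => exact: continuous_fst
  | |- continuous (fun x => snd x) => exact: continuous_snd
  | |- continuous (fun x => (@?f x, @?g x)) =>
      apply: (@continuous_pair _ _ _ f g); solve_continuity
  | |- continuous (fun x => GRing.add (@?f x) (GRing.opp (@?g x))) =>
      apply: (@continuous_sub _ _ _ f g); solve_continuity
  | |- continuous (fun x => GRing.add (@?f x) (@?g x)) =>
      apply: (@continuous_add _ _ _ f g); solve_continuity
  | |- continuous (fun x => GRing.mul (@?f x) (@?g x)) =>
      apply: (@continuous_mul _ _ f g); solve_continuity
  | |- continuous (fun x => GRing.scale (@?f x) (@?g x)) =>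
      apply: (@continuous_scale _ _ _ f g); solve_continuity
  | |- continuous (fun x => @Num.norm _ _ (@?f x)) =>
      apply: (@continuous_normr _ _ f); solve_continuity
  | |- continuous (fun x => fst (@?g x)) =>
      apply: (@continuous_compose _ _ _ g fst); [solve_continuity|exact: continuous_fst]
  | |- continuous (fun x => snd (@?g x)) =>
      apply: (@continuous_compose _ _ _ g snd); [solve_continuity|exact: continuous_snd]
  | H : continuous ?f |- continuous (fun x => ?f (@?g x)) =>
      apply: (@continuous_compose _ _ _ g f _ H); solve_continuity
  end.

Section Curves.
Variable R : realType.
Implicit Types (K : seq 'rV[R]_3) (t : R) (k m : int).

Lemma vertexD K k m : vertex K (k + m * (size K)%:Z) = vertex K k.
Proof. by rewrite /vertex addrC modzMDl. Qed.

Lemma curveD K t m : curve K (t + m%:~R * (size K)%:R) = curve K t.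
Proof.
rewrite /curve -[m%:~R * _]/(m%:~R * (size K)%:Z%:~R) -intrM floorDrz ?intr_int //.
by rewrite intrKfloor [_ + 1]addrAC !vertexD intrD; congr (_ *: _ + _ *: _); ring.
Qed.

Lemma curve_edge K k t : k%:~R <= t <= (k + 1)%:~R ->
  curve K t = (1 - (t - k%:~R)) *: vertex K k + (t - k%:~R) *: vertex K (k + 1).
Proof.
move=> /andP[kt]; rewrite le_eqVlt => /orP[/eqP->|tk].
  rewrite /curve intrKfloor subrr subr0 scale1r scale0r addr0 intrD.
  by rewrite [_ + 1 - _]addrAC subrr add0r subrr scale0r add0r scale1r.
by rewrite /curve (_ : Num.floor t = k) //; apply/floor_def/andP.
Qed.

Lemma curve_vertex K k : curve K k%:~R = vertex K k.
Proof. by rewrite (@curve_edge _ k) ?subrr ?subr0 ?scale1r ?scale0r ?addr0 // lexx ler_int lerDl. Qed.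

(* A formula valid on both sides of the vertex k, whence continuity there. *)
Lemma curve_near K k t : (k - 1)%:~R <= t <= (k + 1)%:~R ->
  curve K t = vertex K k +
    ((`|t - k%:~R| + (t - k%:~R)) / 2) *: (vertex K (k + 1) - vertex K k) +
    ((`|t - k%:~R| - (t - k%:~R)) / 2) *: (vertex K (k - 1) - vertex K k).
Proof.
move=> /andP[k1 k2]; have [kt|tk] := leP k%:~R t.
  rewrite (@curve_edge _ k) ?kt // ger0_norm ?subr_ge0 // subrr mul0r scale0r addr0.
  by apply/rowP => c; rewrite !mxE; field.
rewrite (@curve_edge _ (k - 1)) ?k1 ?subrK ?ltW // ler0_norm ?subr_le0 ?(ltW tk) //.
by rewrite addNr mul0r scale0r addr0 intrB; apply/rowP => c; rewrite !mxE; field.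
Qed.

Lemma curve_continuous K : continuous (curve K).
Proof.
move=> t; set k := Num.floor t.
pose f u := vertex K k +
    ((`|u - k%:~R| + (u - k%:~R)) / 2) *: (vertex K (k + 1) - vertex K k) +
    ((`|u - k%:~R| - (u - k%:~R)) / 2) *: (vertex K (k - 1) - vertex K k).
have kt : k%:~R <= t < (k + 1)%:~R := floor_itv t.
have ft : {near t, f =1 curve K}.
  have : t \in `](k - 1)%:~R, (k + 1)%:~R[.
    by rewrite in_itv /=; move: kt; rewrite !intrD; lra.
  move=> /near_in_itvoo; apply: filterS => u; rewrite in_itv /= => /andP[u1 u2].
  by rewrite (@curve_near _ k) // !ltW.
have cf : continuous f by rewrite /f; solve_continuity.
have ft' : f t = curve K t by exact: (nbhs_singleton ft).
have := cf t; rewrite /continuous_at ft'; apply: cvg_trans.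
exact: near_eq_cvg.
Qed.

End Curves.

Section LinkCurves.
Variables (R : realType) (n : nat).
Implicit Types (L : link R n) (i j : 'I_n).

Lemma link_size_gt0 L i : (0 < size (L i))%N.
Proof. by case: (linkP L). Qed.

Lemma curve_reduce (K : seq 'rV[R]_3) (t : R) : (0 < size K)%N ->
  exists2 s, 0 <= s < (size K)%:R & exists2 m : int, t = s + m%:~R * (size K)%:R &
    curve K t = curve K s.
Proof.
move=> K0; have K0' : 0 < (size K)%:R :> R by rewrite ltr0n.
pose m := Num.floor (t / (size K)%:R).
exists (t - m%:~R * (size K)%:R).
  have /andP[] := floor_itv (t / (size K)%:R).
  rewrite -/m ler_pdivlMr // ltr_pdivrMr // intrD; lra.
exists m; first by rewrite subrK.
by rewrite -[in LHS](subrK (m%:~R * (size K)%:R) t) curveD.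
Qed.

Lemma link_curve_inj L i j (s t : R) : curve (L i) s = curve (L j) t ->
  i = j /\ exists m : int, s = t + m%:~R * (size (L i))%:R.
Proof.
have [s' s'I [m -> ->]] := curve_reduce s (link_size_gt0 L i).
have [t' t'I [m' -> ->]] := curve_reduce t (link_size_gt0 L j).
move=> e; have [ij st] := (linkP L).2 _ _ _ _ s'I t'I e; split => //.
by exists (m - m'); rewrite -ij st intrB; ring.
Qed.

End LinkCurves.

(** Both parameters are rescaled to period 1, so that one grid serves polygons with any numbers of
    vertices. *)
Definition curve_difference (R : realType) (K K' : seq 'rV[R]_3) (a b : R) : 'rV[R]_3 :=
  curve K ((size K)%:R * a) - curve K' ((size K')%:R * b).

(** The retraction of the line onto [0, 1]. It extends a homotopy to all real times, and its
    expression by absolute values makes it visibly continuous. *)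
Definition clamp (R : realType) (t : R) : R := (`|t| - `|t - 1| + 1) / 2.

Lemma clamp01 (R : realType) (t : R) : 0 <= clamp t <= 1.
Proof. by rewrite /clamp; have [] := ger0P t; have [] := ger0P (t - 1); lra. Qed.

Lemma clamp_id (R : realType) (t : R) : 0 <= t <= 1 -> clamp t = t.
Proof. by move=> ?; rewrite /clamp; have [] := ger0P t; have [] := ger0P (t - 1); lra. Qed.

Lemma clamp_continuous (R : realType) : continuous (@clamp R).
Proof. by rewrite /clamp; solve_continuity. Qed.

Lemma homotopic_same_degree (R : realType) (F : R -> R -> R -> 'rV[R]_3)
    (g g' : R -> R -> 'rV[R]_3) :
  continuous (fun p : R * R * R => F p.1.1 p.1.2 p.2) ->
  (forall t a b, 0 <= t <= 1 -> F t a b != 0) ->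
  (forall t a b, F t (a + 1) b = F t a b /\ F t a (b + 1) = F t a b) ->
  (forall a b, F 0 a b = g a b) -> (forall a b, F 1 a b = g' a b) ->
  same_degree g g'.
Proof.
move=> cF F0 per Fg Fg'.
have cc := @clamp_continuous R.
pose G (p : R * R * R) := F (clamp p.1.1) p.1.2 p.2.
have [|||M HM] := @homotopy_same_degree _ G.
- apply: (@continuous_compose _ _ _ (fun p : R * R * R => (clamp p.1.1, p.1.2, p.2)) _ _ cF).
  by solve_continuity.
- by move=> p; apply: F0; exact: clamp01.
- by move=> t a b; apply: per.
have eg : (fun a b => G (0, a, b)) = g.
  by apply/funext => a; apply/funext => b; rewrite /G /= clamp_id ?lexx ?ler01.
have eg' : (fun a b => G (1, a, b)) = g'.
  by apply/funext => a; apply/funext => b; rewrite /G /= clamp_id ?lexx ?ler01.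
by exists M => m /HM; rewrite eg eg'.
Qed.

Lemma within_continuous_comp (T U V : topologicalType) (A : set U) (f : U -> V)
    (g : T -> U) :
  {within A, continuous f} -> continuous g -> (forall x, A (g x)) ->
  continuous (f \o g).
Proof.
move=> /subspace_continuousP cf cg Ag x W Wx.
have HW : nbhs (g x) (fun y => A y -> W (f y)) by exact: (cf _ (Ag x) W Wx).
have {HW} : nbhs x (fun y => A (g y) -> W (f (g y))) by exact: (cg x _ HW).
by move=> HW; change (nbhs x (fun y => W (f (g y)))); apply: filterS HW => y; apply.
Qed.

(** Each H t is injective and keeps the two components disjoint. The isotopy ends at L' up to
    reparametrization, which a second homotopy undoes. *)
Lemma isotopic_same_degree (R : realType) (n : nat) (L L' : link R n) (i j : 'I_n) :
  isotopic L L' -> i != j ->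
  same_degree (curve_difference (L i) (L j)) (curve_difference (L' i) (L' j)).
Proof.
move=> [H [cH Hhomeo H0 HL]] ij.
have [ri [cri _ pri HLi]] := HL i; have [rj [crj _ prj HLj]] := HL j.
have disj (M : link R n) s t : curve (M i) s - curve (M j) t != 0.
  by rewrite subr_eq0; apply/eqP => /link_curve_inj[/eqP]; rewrite (negbTE ij).
pose ni : R := (size (L i))%:R; pose nj : R := (size (L j))%:R.
pose ni' : R := (size (L' i))%:R; pose nj' : R := (size (L' j))%:R.
have curve1 (M : link R n) k t m : curve (M k) (t + m%:R * (size (M k))%:R) = curve (M k) t.
  exact: (curveD _ _ m%:Z).
apply: (@same_degree_trans _ _ (fun a b => curve (L' i) (ri (ni * a)) - curve (L' j) (rj (nj * b)))).
- have cc := @clamp_continuous R.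
  have cont k (f : R * R * R -> R) : continuous f ->
      continuous (fun p : R * R * R => H (clamp p.1.1) (curve (L k) (f p))).
    move=> cf; apply: (@within_continuous_comp _ _ _ _ _
      (fun p : R * R * R => (clamp p.1.1, curve (L k) (f p))) cH); last first.
      by move=> p /=; exact: clamp01.
    have ck := @curve_continuous _ (L k).
    by solve_continuity.
  apply: (@homotopic_same_degree _ (fun t a b =>
     H (clamp t) (curve (L i) (ni * a)) - H (clamp t) (curve (L j) (nj * b)))).
  + by apply: continuous_sub; apply: cont; solve_continuity.
  + move=> t a b t01; rewrite clamp_id // subr_eq0; apply/eqP => e.
    have [G _ [GK _]] := Hhomeo t t01.
    have := disj L (ni * a) (nj * b); rewrite subr_eq0.
    by rewrite -[curve (L i) _](GK) e GK eqxx.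
  + move=> t a b; rewrite !mulrDr !mulr1.
    by have := curve1 L i (ni * a) 1%N; have := curve1 L j (nj * b) 1%N; rewrite !mul1r => -> ->.
  + by move=> a b; rewrite clamp_id ?lexx ?ler01 // !H0.
  + by move=> a b; rewrite clamp_id ?lexx ?ler01 // HLi HLj.
(* Here points only slide along the disjoint curves of L'. Convex combinations of the lift with the
   linear parametrization stay periodic because both advance by exactly one period. *)
- apply: (@homotopic_same_degree _ (fun t a b =>
     curve (L' i) ((1 - t) * ri (ni * a) + t * (ni' * a)) -
     curve (L' j) ((1 - t) * rj (nj * b) + t * (nj' * b)))).
  + have ci := @curve_continuous _ (L' i); have cj := @curve_continuous _ (L' j).
    by solve_continuity.
  + by move=> *; exact: disj.
  + move=> t a b; rewrite !mulrDr !mulr1 pri prj -/ni' -/nj'.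
    have e (x y z : R) : (1 - t) * (x + z) + (t * y + t * z) = (1 - t) * x + t * y + 1 * z by ring.
    by rewrite !e; have := curve1 L' i; have := curve1 L' j => /(_ _ 1%N) -> /(_ _ 1%N) ->.
  + by move=> a b; rewrite !mul0r !addr0 subr0 !mul1r.
  + by move=> a b; rewrite subrr !mul0r !add0r !mul1r.
Qed.

(** * Doubled-delta moves *)

Section Strands.
Variable R : realType.
Implicit Types (p q : 'rV[R]_3) (x y z u : R).

Lemma pt3E x y z :
  [/\ pt3 x y z 0 0 = x, pt3 x y z 0 1 = y & pt3 x y z 0 (2 : 'I_3) = z].
Proof. by split; rewrite mxE. Qed.

Lemma rV3_eq p q : p 0 0 = q 0 0 -> p 0 1 = q 0 1 ->
  p 0 (2 : 'I_3) = q 0 (2 : 'I_3) -> p = q.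
Proof.
move=> e0 e1 e2; apply/rowP => -[[|[|[|c]]] i] //.
- by rewrite (_ : Ordinal i = 0) //; exact/val_inj.
- by rewrite (_ : Ordinal i = 1) //; exact/val_inj.
- by rewrite (_ : Ordinal i = 2) //; exact/val_inj.
Qed.

Lemma turnE p : [/\ turn p 0 0 = - p 0 1, turn p 0 1 = p 0 0 - p 0 1 &
  turn p 0 (2 : 'I_3) = p 0 (2 : 'I_3)].
Proof. exact: pt3E. Qed.

Lemma turn_comb (a b : R) p q : turn (a *: p + b *: q) = a *: turn p + b *: turn q.
Proof. by apply: rV3_eq; rewrite !mxE /=; ring. Qed.

Lemma iter_turn_comb k (a b : R) p q :
  iter k (@turn R) (a *: p + b *: q) = a *: iter k (@turn R) p + b *: iter k (@turn R) q.
Proof. by elim: k => //= k ->; rewrite turn_comb. Qed.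

Lemma over_disk_turn p : over_disk p -> over_disk (turn p).
Proof.
have [t0 t1 _] := turnE p.
case=> p0 p1 p01; split; rewrite ?t0 ?t1 ?normrN //.
by rewrite opprB addrA addNr add0r normrN.
Qed.

Lemma over_disk_comb (t : R) p q : 0 <= t <= 1 ->
  over_disk p -> over_disk q -> over_disk ((1 - t) *: p + t *: q).
Proof.
move=> t01 [p0 p1 p01] [q0 q1 q01].
have conv a b : `|a| <= 12 -> `|b| <= 12 -> `|(1 - t) * a + t * b| <= 12.
  rewrite !ler_norml => ? ?; nra.
split; rewrite !mxE ?conv //.
have -> : (1 - t) * p 0 0 + t * q 0 0 - ((1 - t) * p 0 1 + t * q 0 1) =
  (1 - t) * (p 0 0 - p 0 1) + t * (q 0 0 - q 0 1) by ring.
exact: conv.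
Qed.

(* In the coordinates of arc 0, the strand with offset u, for the position s of
   the triangle; w vanishes at its endpoints and is 1 on its middle segment. *)
Definition on_strand (s h u x y z w : R) : Prop :=
  [/\ 0 <= w <= 1, y = x / 2 + 2 * s * w + u &
   [\/ -12 <= x <= -8 /\ w = (x + 12) / 4,
       -8 <= x <= 8 /\ (w = 1 /\ z = - (s * h * x / 8)) |
       8 <= x <= 12 /\ w = (12 - x) / 4]].

(** For given s, the value of w is determined by x, so two parallel strands differ in y by 2u. *)
Lemma parallel_strands (s h u x y z w y' z' w' : R) :
  on_strand s h u x y z w -> on_strand s h (- u) x y' z' w' -> y = y' -> u = 0.
Proof.
move=> [w01 -> H] [w01' -> H'] e.
have ww : w = w'.
  by case: H => -[? H]; case: H' => -[? H']; first [lra|case: H => ? ?; lra|case: H' => ? ?; lra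
    | case: H => ? ?; case: H' => ? ?; lra].
move: e; rewrite ww; lra.
Qed.

(* Strands of consecutive arcs can only meet in projection along their middle
   segments, at a point where the bump 1 - s^2 keeps their heights apart. *)
Lemma crossing_strands (s h u u' x y z w x' y' z' w' : R) :
  -1 <= s <= 1 -> h = 1 \/ h = -1 -> u = 1 \/ u = -1 -> u' = 1 \/ u' = -1 ->
  on_strand s h u x y z w -> on_strand s h u' x' y' z' w' ->
  x = - y' -> y = x' - y' -> 0 < h * (z - z') + (1 - s ^+ 2) * (w * w').
Proof.
move=> s1 hE uE uE' [w01 yE H] [w01' yE' H'] e e'.
have b : - w <= s * w <= w by nra.
have b' : - w' <= s * w' <= w' by nra.
have u1 : -1 <= u <= 1 by case: uE => ->; lra.
have u1' : -1 <= u' <= 1 by case: uE' => ->; lra.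
(* Every strand satisfies |y'| <= 7, so x = - y' excludes the end segments, where |x| >= 8. *)
case: H => -[? H]; [exfalso|case: H => wE zE|exfalso]; last 1 first.
- by case: H' => -[? H']; [|case: H'|]; lra.
- by case: H' => -[? H']; [|case: H'|]; lra.
(* Now w = 1, so x' = y - x = - x / 2 + 2 s + u has absolute value at most 7 as well. *)
case: H' => -[? H']; [exfalso; lra|case: H' => wE' zE'|exfalso; lra].
have xx : x - x' = - 8 * s - 2 * (u + u') by move: yE yE'; rewrite wE wE'; lra.
(* The signed gap in height alone is s^2 + s (u + u') / 4, which vanishes at s = 0; the bump
   replaces s^2 by 1, and the total is at least 1/2. *)
have -> : h * (z - z') + (1 - s ^+ 2) * (w * w') = 1 + s * (u + u') / 4.
  have hh : h * h = 1 by case: hE => ->; lra.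
  rewrite zE zE' wE wE'.
  have -> : h * (- (s * h * x / 8) - - (s * h * x' / 8)) = - (h * h) * s * (x - x') / 8 by field.
  by rewrite hh xx; field.
by case: uE => ->; case: uE' => ->; lra.
Qed.

End Strands.

Section Weights.
Variable R : realType.
Implicit Types (p q : 'rV[R]_3) (s h : R) (k : 'I_3) (e : bool).

(* The middle vertices of arc k are the points of the tangle at which the k-th
   of the coordinates x, y - x, y has absolute value 8. *)
Definition weight p : 'rV[R]_3 :=
  if `[< over_disk p >] then
    pt3 (`|p 0 0| == 8)%:R (`|p 0 1 - p 0 0| == 8)%:R (`|p 0 1| == 8)%:R
  else 0.

Definition axis k : 'rV[R]_3 := delta_mx 0 k.

Definition strand_weight (j : nat) : R := ((j == 1%N) || (j == 2%N))%:R.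

Definition strand_vertex s h k e (j : nat) : 'rV[R]_3 := (strand s h k e)`_j.

Lemma strand_vertexE s h k e j : (j < 4)%N ->
  strand_vertex s h k e j = iter k (@turn R) (strand_vertex s h 0 e j).
Proof. by move=> j4; rewrite /strand_vertex /strand (nth_map 0). Qed.

Lemma strand_over_disk s h k e j : -1 <= s <= 1 -> (j < 4)%N ->
  over_disk (strand_vertex s h k e j).
Proof.
move=> s1 j4; rewrite strand_vertexE //.
have : over_disk (strand_vertex s h 0 e j).
  have u1 : -1 <= ((-1) ^+ e : R) <= 1 by case: e => /=; lra.
  move: u1; case: j j4 => [|[|[|[|j]]]] // _; rewrite /strand_vertex /=;
    move: ((-1) ^+ e) => u u1; rewrite /over_disk /=;
    by match goal with |- context [pt3 ?x ?y ?z] => have [-> -> _] := pt3E x y z end;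
       split; rewrite ler_norml; lra.
by elim: (nat_of_ord k) => //= m IH /IH; exact: over_disk_turn.
Qed.

(** At the vertices of arc 0, y and y - x are at most 7 in absolute value, while |x| is 8 at the
    middle vertices and 12 at the ends. A turn permutes x, y - x, y cyclically up to sign. *)
Lemma weight_strand h k e j : (j < 4)%N ->
  weight (strand_vertex 1 h k e j) = strand_weight j *: axis k.
Proof.
move=> j4; have one : -1 <= (1 : R) <= 1 by lra.
rewrite /weight (asboolT (strand_over_disk _ _ _ one j4)) strand_vertexE //.
have u1 : -1 <= ((-1) ^+ e : R) <= 1 by case: e => /=; lra.
have ne8 (v : R) : -8 < v < 8 \/ 8 < v \/ v < -8 -> (`|v| == 8) = false.
  by move=> H; apply/negbTE/eqP; have [v0|v0] := leP 0 v;
    rewrite ?(ger0_norm v0) ?(ltr0_norm v0); lra.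
have [x [y [z [-> [H1 H2 H3]]]]] : exists x y z,
    strand_vertex 1 h 0 e j = pt3 x y z /\
    [/\ (`|x| == 8) = ((j == 1%N) || (j == 2%N)), (`|y - x| == 8) = false &
        (`|y| == 8) = false].
  move: u1; case: j j4 => [|[|[|[|j]]]] // _; rewrite /strand_vertex /=;
    move: ((-1) ^+ e) => u u1; do 3! eexists; (split; first reflexivity);
    split; first [by rewrite ?normrN normr_nat eqxx | by rewrite ne8 //; lra].
have [e0 e1 _] := pt3E x y z.
case: (ord3 k) => [|[|]] -> /=; rewrite ?(turnE _).1 ;
  repeat match goal with |- context [turn ?p] => have [-> -> _] := turnE p end.
all: rewrite ?e0 ?e1.
- by apply: rV3_eq; rewrite !mxE /= ?H1 ?H2 ?H3 ?mulr0 ?mulr1.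
- rewrite (_ : x - y - - y = x); last by ring.
  rewrite normrN distrC.
  by apply: rV3_eq; rewrite !mxE /= ?H1 ?H2 ?H3 ?mulr0 ?mulr1.
- rewrite (_ : - y - (x - y) - - (x - y) = - y); last by ring.
  rewrite (_ : - y - (x - y) = - x) ?normrN; last by ring.
  rewrite distrC.
  by apply: rV3_eq; rewrite !mxE /= ?H1 ?H2 ?H3 ?mulr0 ?mulr1.
Qed.

(* Seen in the coordinates of arc 0, the point at parameter j + r of strand
   (k, e), when its position is interpolated between those for 1 and -1. *)
Lemma strand_point h k e j r t : (j < 3)%N -> 0 <= r <= 1 -> 0 <= t <= 1 ->
  exists x y z, on_strand (1 - 2 * t) h ((-1) ^+ e) x y z
      ((1 - r) * strand_weight j + r * strand_weight j.+1) /\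
    (1 - t) *: ((1 - r) *: strand_vertex 1 h k e j + r *: strand_vertex 1 h k e j.+1) +
    t *: ((1 - r) *: strand_vertex (-1) h k e j + r *: strand_vertex (-1) h k e j.+1) =
    iter k (@turn R) (pt3 x y z).
Proof.
move=> j3 r01 t01.
have tE s i : (i < 4)%N -> strand_vertex s h k e i = iter k (@turn R) (strand_vertex s h 0 e i).
  exact: strand_vertexE.
have j4 : (j < 4)%N by lia.
rewrite (tE 1 j) // (tE 1 j.+1) // (tE (-1) j) // (tE (-1) j.+1) // -!iter_turn_comb.
set p := (1 - t) *: _ + _.
exists (p 0 0), (p 0 1), (p 0 (2 : 'I_3)); split; last first.
  by congr (iter k _ _); 
    have [e0 e1 e2] := pt3E (p 0 0) (p 0 1) (p 0 (2 : 'I_3)); apply: rV3_eq; rewrite ?e0 ?e1 ?e2.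
rewrite /p /strand_vertex.
case: j j3 {p tE j4} => [|[|[|j]]] // _; rewrite /= /strand_weight /=; move: ((-1) ^+ e) => u;
  split; rewrite ?mxE /=; try (lra || field).
- by constructor 1; split; [lra|field].
- by constructor 2; split; [lra|split; field].
- by constructor 3; split; [lra|field].
Qed.

End Weights.

Section DoubledDelta.
Variable R : realType.

Lemma curve_walk (K : seq 'rV[R]_3) (a d m : int) (r : R) : d = 1 \/ d = -1 ->
  0 <= r <= 1 ->
  curve K ((a + d * m)%:~R + d%:~R * r) =
  (1 - r) *: vertex K (a + d * m) + r *: vertex K (a + d * (m + 1)).
Proof.
move=> dE r01; case: dE => ->.
  rewrite !mul1r (@curve_edge _ _ (a + m)); last by rewrite !intrD; lra.
  by rewrite (addrC _%:~R r) addrK addrA.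
rewrite (@curve_edge _ _ (a - 1 * (m + 1))); last by rewrite !(intrD, intrB, intrM, mulN1r, mul1r, intrN); lra.
have -> : (a + -1 * m)%:~R + (-1)%:~R * r - (a - 1 * (m + 1))%:~R = 1 - r :> R.
  by rewrite !(intrD, intrB, intrM, mulN1r, mul1r, intrN); ring.
rewrite addrC; by congr (_ *: vertex K _ + _ *: vertex K _); ring.
Qed.

Lemma vertex_weights (K : seq 'rV[R]_3) (m : int) : (0 < size K)%N ->
  vertex [seq weight p | p <- K] m = weight (vertex K m).
Proof.
move=> K0; rewrite /vertex size_map (nth_map 0) //.
by rewrite -ltz_nat gez0_abs ?ltz_pmod ?modz_ge0 // -lt0n.
Qed.

Lemma sign_int (b : bool) : ((-1) ^+ b : int) = 1 \/ ((-1) ^+ b : int) = -1.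
Proof. by case: b; [right|left]. Qed.

Variables (n : nat) (L L' : link R n) (h : R).
Variables (c : 'I_3 -> bool -> 'I_n) (a : 'I_3 -> bool -> int) (o : 'I_3 -> bool).
Let dir k e : int := (-1) ^+ (o k (+) e).
Hypothesis strands : forall k e (j : 'I_4),
  vertex (L (c k e)) (a k e + dir k e * j%:Z) = (strand 1 h k e)`_j /\
  vertex (L' (c k e)) (a k e + dir k e * j%:Z) = (strand (-1) h k e)`_j.
Hypothesis only_strands : forall i (t : R), over_disk (curve (L i) t) ->
  exists k e (s : R), 0 <= s <= 3 /\
    curve (L i) t = curve (L (c k e)) ((a k e)%:~R + (dir k e)%:~R * s).
Hypothesis same_size : forall i, size (L' i) = size (L i).
Hypothesis same_outside : forall i k, ~ over_disk (vertex (L i) k) ->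
  vertex (L' i) k = vertex (L i) k.

Definition weights i : seq 'rV[R]_3 := [seq weight p | p <- L i].

Definition strand_comb (s : R) k e j (r : R) :=
  (1 - r) *: strand_vertex s h k e j + r *: strand_vertex s h k e j.+1.

Lemma vertices_on_strand k e (j : nat) : (j < 4)%N ->
  [/\ vertex (L (c k e)) (a k e + dir k e * j%:Z) = strand_vertex 1 h k e j,
      vertex (L' (c k e)) (a k e + dir k e * j%:Z) = strand_vertex (-1) h k e j
    & vertex (weights (c k e)) (a k e + dir k e * j%:Z) = strand_weight R j *: axis R k].
Proof.
move=> j4; have [s1 s2] := strands k e (Ordinal j4); rewrite /= in s1 s2.
by split => //; rewrite vertex_weights ?link_size_gt0 // s1 weight_strand.
Qed.

Lemma curves_on_strand k e (j : nat) (r : R) : (j < 3)%N -> 0 <= r <= 1 ->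
  let t := (a k e)%:~R + (dir k e)%:~R * (j%:R + r) in
  [/\ curve (L (c k e)) t = strand_comb 1 k e j r,
      curve (L' (c k e)) t = strand_comb (-1) k e j r
    & curve (weights (c k e)) t =
      ((1 - r) * strand_weight R j + r * strand_weight R j.+1) *: axis R k].
Proof.
move=> j3 r01 /=; have j4 : (j < 4)%N by lia.
have [v1 v2 v3] := vertices_on_strand k e j4.
have [w1 w2 w3] := vertices_on_strand k e (j3 : (j.+1 < 4)%N).
have dirE := sign_int (o k (+) e).
have -> : (a k e)%:~R + (dir k e)%:~R * (j%:R + r) =
  (a k e + dir k e * j%:Z)%:~R + (dir k e)%:~R * r by rewrite intrD intrM; ring.
have jS : (j%:Z + 1) = j.+1%:Z by rewrite -addn1 PoszD.
rewrite !curve_walk // jS v1 v2 v3 w1 w2 w3; split => //.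
by rewrite !scalerA -scalerDl.
Qed.

Lemma strand_parameter (s : R) : 0 <= s <= 3 ->
  exists j r, [/\ (j < 3)%N, 0 <= r <= 1 & s = j%:R + r].
Proof.
move=> s3; have [s1|s1] := leP s 1; first by exists 0%N, s; split => //; lra.
have [s2|s2] := leP s 2; first by exists 1%N, (s - 1); split => //; lra.
by exists 2%N, (s - 2); split => //; lra.
Qed.

Definition on_tangle i (t : R) : Prop :=
  exists k e j r, [/\ (j < 3)%N, 0 <= r <= 1, i = c k e &
    [/\ curve (L i) t = strand_comb 1 k e j r,
        curve (L' i) t = strand_comb (-1) k e j r
      & curve (weights i) t =
        ((1 - r) * strand_weight R j + r * strand_weight R j.+1) *: axis R k]].

Lemma strand_on_tangle k e (s : R) (m : int) : 0 <= s <= 3 ->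
  on_tangle (c k e) ((a k e)%:~R + (dir k e)%:~R * s + m%:~R * (size (L (c k e)))%:R).
Proof.
move=> /strand_parameter[j [r [j3 r01 ->]]]; exists k, e, j, r; split => //.
have [<- <- <-] := curves_on_strand k e j3 r01.
split; first by rewrite curveD.
  by rewrite -same_size curveD.
by rewrite -[size (L _)](size_map (@weight R)) curveD.
Qed.

Lemma over_disk_parameter i (t : R) : over_disk (curve (L i) t) ->
  exists k e (s : R) (m : int), [/\ 0 <= s <= 3, i = c k e &
    t = (a k e)%:~R + (dir k e)%:~R * s + m%:~R * (size (L i))%:R].
Proof.
move=> /only_strands[k [e [s [s3 /link_curve_inj[ik [m ->]]]]]].
by exists k, e, s, m.
Qed.

Lemma on_tangle_over_disk i (t : R) : on_tangle i t -> over_disk (curve (L i) t).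
Proof.
move=> [k [e [j [r [j3 r01 _ [-> _ _]]]]]].
by apply: over_disk_comb => //; apply: strand_over_disk; (lra || lia).
Qed.

(** A vertex over the disk is a vertex of a strand. Both edges at a middle vertex belong to the
    strand, so a neighbour of a point off the disk can only be an end of a strand, where the two
    tangles agree and the weight is 0. *)
Lemma off_tangle_vertex i (t : R) (m : int) : ~ over_disk (curve (L i) t) ->
  m%:~R - 1 <= t <= m%:~R + 1 ->
  vertex (L' i) m = vertex (L i) m /\ vertex (weights i) m = 0.
Proof.
move=> out tm; rewrite vertex_weights ?link_size_gt0 //.
have [inside|outside] := pselect (over_disk (vertex (L i) m)); last first.
  by rewrite same_outside // /weight asboolF.
have : over_disk (curve (L i) m%:~R) by rewrite curve_vertex.
move=> /over_disk_parameter[k [e [s [m' [s3 ik mE]]]]]; subst i.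
have dirE := sign_int (o k (+) e); rewrite -/(dir k e) in dirE.
have dd : dir k e * dir k e = 1 by case: dirE => ->.
have ddR : (dir k e)%:~R * (dir k e)%:~R = 1 :> R by rewrite -intrM dd.
pose z : int := dir k e * (m - a k e - m' * (size (L (c k e)))%:Z).
(* The strand parameter of a vertex of the link is an integer, since strands are traversed one
   vertex per unit of time. *)
have sz : s = z%:~R.
  rewrite /z intrM 2!intrB intrM mE.
  transitivity ((dir k e)%:~R * ((dir k e)%:~R * s)); first by rewrite mulrA ddR mul1r.
  by congr (_ * _); rewrite -[_%:Z%:~R]/((size (L (c k e)))%:R : R); ring.
have [j zj] : exists j : nat, z = j%:Z.
  have : 0 <= z by rewrite -(ler0z R) -sz; lra.
  by case: z {sz} => // j _; exists j.
have j4 : (j < 4)%N.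
  have : z%:~R <= 3%:~R :> R by rewrite -sz; lra.
  by rewrite ler_int zj; lia.
have mj : m = a k e + dir k e * j%:Z + m' * (size (L (c k e)))%:Z.
  by rewrite -zj /z mulrA dd mul1r; ring.
have [v1 v2 v3] := vertices_on_strand k e j4.
rewrite vertex_weights ?link_size_gt0 // in v3.
have [jmid|jend] := boolP ((j == 1%N) || (j == 2%N)).
  case: out; apply: on_tangle_over_disk.
  pose y := s + (dir k e)%:~R * (t - m%:~R).
  have y3 : 0 <= y <= 3.
    have s12 : 1 <= s <= 2.
      by rewrite sz zj; case/orP: jmid => /eqP -> /=; rewrite -[_%:~R]/(_%:R); lra.
    by rewrite /y; case: dirE => ->; lra.
  have -> : t = (a k e)%:~R + (dir k e)%:~R * y + m'%:~R * (size (L (c k e)))%:R.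
    by rewrite /y mulrDr mulrA ddR mE; ring.
  exact: strand_on_tangle.
rewrite mj vertexD -{1}same_size vertexD v1 v2.
have e0 : strand_weight R j = 0 by rewrite /strand_weight (negbTE jend).
split; last by rewrite -v1 v3 e0 scale0r.
rewrite [LHS]strand_vertexE // [RHS]strand_vertexE //; congr (iter k _ _).
by case: j j4 jend {mj zj v1 v2 v3 e0} => [|[|[|[|j]]]].
Qed.

Lemma tangle_position i (t : R) : on_tangle i t \/
  [/\ ~ over_disk (curve (L i) t), curve (L' i) t = curve (L i) t
    & curve (weights i) t = 0].
Proof.
have [inside|outside] := pselect (over_disk (curve (L i) t)); [left|right].
  have [k [e [s [m [s3 ik ->]]]]] := over_disk_parameter inside.
  by subst i; exact: strand_on_tangle.
pose m := Num.floor t; have mt : m%:~R <= t < (m + 1)%:~R := floor_itv t.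
have me : m%:~R <= t <= (m + 1)%:~R by case/andP: mt => -> /ltW ->.
have [v1 w1] : vertex (L' i) m = vertex (L i) m /\ vertex (weights i) m = 0.
  by apply: off_tangle_vertex outside _; move: me; rewrite intrD; lra.
have [v2 w2] : vertex (L' i) (m + 1) = vertex (L i) (m + 1) /\ vertex (weights i) (m + 1) = 0.
  by apply: off_tangle_vertex outside _; move: me; rewrite intrD; lra.
split => //; first by rewrite !(@curve_edge _ _ m) // v1 v2.
by rewrite (@curve_edge _ _ m) // w1 w2 !scaler0 addr0.
Qed.

End DoubledDelta.

(** This is det(u, v, (1, 1, 1)): on the axes of two arcs it is 1, -1 or 0 according as the second
    arc follows, precedes or equals the first, like the over/under pattern. Being bilinear, it is
    continuous along the curves and vanishes off the tangle. *)
Definition cyclic_form (R : realType) (u v : 'rV[R]_3) : R :=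
  u 0 0 * v 0 1 - u 0 1 * v 0 0 + (u 0 1 * v 0 (2 : 'I_3) - u 0 (2 : 'I_3) * v 0 1)
  + (u 0 (2 : 'I_3) * v 0 0 - u 0 0 * v 0 (2 : 'I_3)).

Lemma cyclic_form_continuous (R : realType) (T : topologicalType) (f g : T -> 'rV[R]_3) :
  continuous f -> continuous g -> continuous (fun x => cyclic_form (f x) (g x)).
Proof.
move=> cf cg; rewrite /cyclic_form.
have coord (e : T -> 'rV[R]_3) m : continuous e -> continuous (fun x => e x 0 m).
  move=> ce; apply: (@continuous_compose _ _ _ e (fun p : 'rV[R]_3 => p 0 m) ce).
  exact: coord_continuous.
have f0 := coord f 0 cf; have f1 := coord f 1 cf; have f2 := coord f 2 cf.
have g0 := coord g 0 cg; have g1 := coord g 1 cg; have g2 := coord g 2 cg.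
by solve_continuity.
Qed.

Lemma cyclic_form_axes (R : realType) (w w' : R) (k k' : 'I_3) :
  cyclic_form (w *: axis R k) (w' *: axis R k') =
  w * w' * ((k' == k + 1)%:R - (k == k' + 1)%:R).
Proof.
by case: (ord3 k) => [|[|]] ->; case: (ord3 k') => [|[|]] ->;
   rewrite /cyclic_form !mxE /=; ring.
Qed.

Lemma turn_pt3 (R : realType) (x y z : R) : turn (pt3 x y z) = pt3 (- y) (x - y) z.
Proof. by rewrite /turn; have [-> -> ->] := pt3E x y z. Qed.

Lemma same_arc_strands (R : realType) (s h u u' x y z w x' y' z' w' : R) (k : nat) :
  on_strand s h u x y z w -> on_strand s h u' x' y' z' w' -> u = - u' -> u' != 0 ->
  iter k (@turn R) (pt3 x y z) 0 0 = iter k (@turn R) (pt3 x' y' z') 0 0 ->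
  iter k (@turn R) (pt3 x y z) 0 1 = iter k (@turn R) (pt3 x' y' z') 0 1 -> False.
Proof.
move=> H H' uu /eqP u0 e0 e1.
have [ex ey] : x = x' /\ y = y'.
  elim: k e0 e1 => [|k IH] /=.
    by have [-> -> _] := pt3E x y z; have [-> -> _] := pt3E x' y' z'.
  have [-> -> _] := turnE (iter k (@turn R) (pt3 x y z)).
  have [-> -> _] := turnE (iter k (@turn R) (pt3 x' y' z')).
  by move=> e e'; apply: IH; lra.
apply: u0; subst x' u; rewrite -[u'](opprK) in H'.
have := parallel_strands H H' ey; lra.
Qed.

Lemma iter_turn_z (R : realType) k (p : 'rV[R]_3) :
  iter k (@turn R) p 0 (2 : 'I_3) = p 0 (2 : 'I_3).
Proof. by elim: k => //= k <-; have [_ _ ->] := turnE (iter k (@turn R) p). Qed.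

Lemma next_arc_strands (R : realType) (s h u u' x y z w x' y' z' w' : R) (k : 'I_3) :
  -1 <= s <= 1 -> h = 1 \/ h = -1 -> u = 1 \/ u = -1 -> u' = 1 \/ u' = -1 ->
  on_strand s h u x y z w -> on_strand s h u' x' y' z' w' ->
  let p := iter k (@turn R) (pt3 x y z) in
  let p' := iter (k + 1)%R (@turn R) (pt3 x' y' z') in
  p 0 0 = p' 0 0 -> p 0 1 = p' 0 1 ->
  p 0 (2 : 'I_3) - p' 0 (2 : 'I_3) + (1 - s ^+ 2) * h * (w * w') != 0.
Proof.
move=> s1 hE uE uE' H H' p p'; rewrite /p /p' !iter_turn_z.
have [_ _ ->] := pt3E x y z; have [_ _ ->] := pt3E x' y' z'.
move=> px py.
have [ex ey] : x = - y' /\ y = x' - y'.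
  by move: px py; case: (ord3 k) => [|[|]] -> /=; rewrite !turn_pt3 !mxE /=; lra.
have := crossing_strands s1 hE uE uE' H H' ex ey.
have hh : h * h = 1 by case: hE => ->; lra.
apply: contraTneq => e; rewrite -leNgt.
have -> : h * (z - z') + (1 - s ^+ 2) * (w * w') =
  h * (z - z' + (1 - s ^+ 2) * h * (w * w')) + (1 - h * h) * (1 - s ^+ 2) * (w * w') by ring.
by rewrite e hh subrr !mul0r mulr0 addr0.
Qed.

(** Off the tangle the curves do not move. Within it they stay over the disk, which is convex, and
    so avoid the points off the disk. It remains to compare two points of the tangle, on the same
    arc or on two different ones. *)
Lemma doubled_delta_same_degree (R : realType) (n : nat) (L L' : link R n) (i j : 'I_n) :
  doubled_delta L L' -> i != j ->
  same_degree (curve_difference (L i) (L j)) (curve_difference (L' i) (L' j)).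
Proof.
move=> [h [c [a [orient [hE strands only_strands same_size same_outside]]]]] ij.
have pos := tangle_position strands only_strands same_size same_outside.
pose P t k s : 'rV[R]_3 := (1 - t) *: curve (L k) s + t *: curve (L' k) s.
(* At time t the triangle is in position s = 1 - 2t, so the factor 1 - s^2 removes the bump at both
   ends of the homotopy. *)
pose B t s s' : R := (1 - (1 - 2 * t) * (1 - 2 * t)) * h *
  cyclic_form (curve (weights L i) s) (curve (weights L j) s').
pose ni : R := (size (L i))%:R; pose nj : R := (size (L j))%:R.
have sizeW k : size (weights L k) = size (L k) by rewrite size_map.
apply: (@homotopic_same_degree _ (fun t a b =>
  P t i (ni * a) - P t j (nj * b) + B t (ni * a) (nj * b) *: pt3 0 0 1)).
- have ci := @curve_continuous _ (L i); have ci' := @curve_continuous _ (L' i).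
  have cj := @curve_continuous _ (L j); have cj' := @curve_continuous _ (L' j).
  have wi := @curve_continuous _ (weights L i).
  have wj := @curve_continuous _ (weights L j).
  have cf : continuous (fun p : R * R * R =>
      cyclic_form (curve (weights L i) (ni * p.1.2)) (curve (weights L j) (nj * p.2))).
    by apply: cyclic_form_continuous; solve_continuity.
  by rewrite /P /B; solve_continuity.
- move=> t x y t01; set s := ni * x; set s' := nj * y.
  have weights0 u v : u = 0 \/ v = 0 -> cyclic_form u v = 0 :> R.
    by case=> ->; rewrite /cyclic_form !mxE !(mul0r, mulr0, subr0, addr0).
  have t1 : -1 <= 1 - 2 * t <= 1 by lra.
  have P_in k u : on_tangle L L' h c k u -> over_disk (P t k u).
    move=> [m [e [q [r [q3 r01 _ [c1 c2 _]]]]]]; rewrite /P c1 c2.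
    apply: over_disk_comb => //; apply: over_disk_comb => //;
      by apply: strand_over_disk; (lra || lia).
  have P_out k u : curve (L' k) u = curve (L k) u -> P t k u = curve (L k) u.
    by rewrite /P => ->; rewrite -scalerDl subrK scale1r.
  apply/eqP => F0.
  have B0 u v : curve (weights L i) u = 0 \/ curve (weights L j) v = 0 -> B t u v = 0.
    by rewrite /B => /weights0 ->; rewrite mulr0.
  have [Ti|[oi ei wi]] := pos i s; have [Tj|[oj ej wj]] := pos j s'; last 3 first.
  + move: F0; rewrite (B0 s s') ?scale0r ?addr0; last by right.
    by rewrite (P_out j) // => /eqP; rewrite subr_eq0 => /eqP e; apply: oj; rewrite -e; exact: P_in.
  + move: F0; rewrite (B0 s s') ?scale0r ?addr0; last by left.
    by rewrite (P_out i) // => /eqP; rewrite subr_eq0 => /eqP e; apply: oi; rewrite e; exact: P_in.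
  + move: F0; rewrite (B0 s s') ?scale0r ?addr0; last by left.
    rewrite (P_out i) // (P_out j) // => /eqP; rewrite subr_eq0 => /eqP /link_curve_inj[/eqP].
    by rewrite (negbTE ij).
  case: Ti => [k [e [q [r [q3 r01 ik [ci ci' wi]]]]]].
  case: Tj => [k' [e' [q' [r' [q3' r01' jk' [cj cj' wj]]]]]].
  have [x1 [y1 [z [S]]]] := strand_point h k e q3 r01 t01.
  have [x1' [y1' [z' [S']]]] := strand_point h k' e' q3' r01' t01.
  set w := (1 - r) * _ + _ in S; set w' := (1 - r') * _ + _ in S'.
  rewrite -[LHS]/((1 - t) *: strand_comb h 1 k' e' q' r' + t *: strand_comb h (-1) k' e' q' r') => Pj.
  rewrite -[LHS]/((1 - t) *: strand_comb h 1 k e q r + t *: strand_comb h (-1) k e q r) => Pi.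
  rewrite -cj -cj' -/(P t j s') in Pj; rewrite -ci -ci' -/(P t i s) in Pi.
  have coord m : (P t i s - P t j s' + B t s s' *: pt3 0 0 1) 0 m = 0 by rewrite F0 mxE.
  have e0 : P t i s 0 0 = P t j s' 0 0.
    by have := coord 0; rewrite !mxE mulr0 addr0 => /eqP; rewrite subr_eq0 => /eqP.
  have e1 : P t i s 0 1 = P t j s' 0 1.
    by have := coord 1; rewrite !mxE mulr0 addr0 => /eqP; rewrite subr_eq0 => /eqP.
  have e2 : P t i s 0 2 - P t j s' 0 2 + B t s s' = 0.
    by have := coord 2; rewrite !mxE mulr1.
  have uE (b : bool) : (-1) ^+ b = 1 :> R \/ (-1) ^+ b = -1 :> R by case: b; [right|left].
  have Bkk : B t s s' = (1 - (1 - 2 * t) ^+ 2) * h *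
      (w * w' * ((k' == k + 1)%:R - (k == k' + 1)%:R)).
    by rewrite /B wi wj cyclic_form_axes expr2.
  have kk : k = k' \/ k' = k + 1 \/ k = k' + 1.
    case: (ord3 k) => [|[|]] ->; case: (ord3 k') => [|[|]] ->;
      by [left|right; left; apply/val_inj|right; right; apply/val_inj].
  have kne (m : 'I_3) : (m == m + 1 + 1) = false by case: (ord3 m) => [|[|]] ->.
  rewrite Pi Pj in e0 e1 e2; case: kk => [kk|[kk|kk]].
  (* As i and j differ, two strands of the same arc must be its two parallel copies. *)
  + subst k'; have ee : e' = ~~ e.
      apply/eqP; move: ij; rewrite ik jk'; apply: contra_neqT.
      by case: (e) (e') => -[].
    apply: (same_arc_strands S S') e0 e1; first by rewrite ee; case: (e); rewrite /= ?opprK.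
    by case: (uE e') => ->; rewrite ?oppr_eq0 oner_eq0.
  + subst k'; move: (next_arc_strands t1 hE (uE e) (uE e') S S' e0 e1).
    by rewrite -e2 Bkk eqxx kne subr0 mulr1 eqxx.
  + subst k; move: (next_arc_strands t1 hE (uE e') (uE e) S' S (esym e0) (esym e1)).
    apply/negP; rewrite negbK; apply/eqP.
    move: e2; rewrite Bkk eqxx kne sub0r mulrN1 => e2.
    apply: oppr_inj; rewrite oppr0 -[RHS]e2. ring.
- move=> t x y.
  have shift (K : seq 'rV[R]_3) m z : size K = m -> curve K (z + m%:R) = curve K z.
    by move=> <-; have := curveD K z 1; rewrite mul1r.
  rewrite /P /B /ni /nj !mulrDr !mulr1.
  by rewrite !(shift _ _ _ (erefl _)) !(shift _ _ _ (same_size _)) !(shift _ _ _ (sizeW _)).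
- by move=> x y; rewrite /P /B mulr0 subr0 mulr1 subrr !mul0r scale0r addr0 !scale1r !scale0r !addr0.
- move=> x y; rewrite /P /B mulr1 /curve_difference !same_size.
  rewrite (_ : 1 - (1 - 2) * (1 - 2) = 0) ?mul0r ?scale0r ?addr0; last by ring.
  by rewrite subrr !scale0r !add0r !scale1r.
Qed.

(** * Polyhedral surfaces with integer vertices *)

(** Binary integers allow the geometric conditions to be checked by [vm_compute]; [vec] transfers
    them to real points. *)
Definition Z3 : Type := (Z * Z * Z)%type.

Definition zsub (p q : Z3) : Z3 :=
  (Z.sub p.1.1 q.1.1, Z.sub p.1.2 q.1.2, Z.sub p.2 q.2).

Definition zdot (p q : Z3) : Z :=
  Z.add (Z.add (Z.mul p.1.1 q.1.1) (Z.mul p.1.2 q.1.2)) (Z.mul p.2 q.2).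

Definition zdet (u v w : Z3) : Z :=
  zdot u (Z.sub (Z.mul v.1.2 w.2) (Z.mul v.2 w.1.2),
          Z.sub (Z.mul v.2 w.1.1) (Z.mul v.1.1 w.2),
          Z.sub (Z.mul v.1.1 w.1.2) (Z.mul v.1.2 w.1.1)).

Section IntegerPoints.
Variable R : realType.
Implicit Types (p q u v w : 'rV[R]_3).

Definition zr (z : Z) : R := (int_of_Z z)%:~R.

Lemma zrD a b : zr (Z.add a b) = zr a + zr b.
Proof. by rewrite /zr -[Z.add a b]/(a + b) rmorphD intrD. Qed.

Lemma zrM a b : zr (Z.mul a b) = zr a * zr b.
Proof. by rewrite /zr -[Z.mul a b]/(a * b) rmorphM intrM. Qed.

Lemma zrB a b : zr (Z.sub a b) = zr a - zr b.
Proof. by rewrite -Z.add_opp_r zrD /zr -[Z.opp b]/(- b) rmorphN intrN. Qed.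

Lemma zr_ge0 a : Z.leb 0 a -> 0 <= zr a.
Proof. by case: a => // a _; rewrite /zr /= ler0z. Qed.

Lemma zr_gt0 a : Z.ltb 0 a -> 0 < zr a.
Proof. by case: a => // a _; rewrite /zr /= ltr0z -[0]/(Posz 0) ltz_nat; lia. Qed.

Lemma zr_le a b : Z.leb a b -> zr a <= zr b.
Proof. by move=> ab; rewrite -subr_ge0 -zrB zr_ge0 //; lia. Qed.

Lemma zr_lt a b : Z.ltb a b -> zr a < zr b.
Proof. by move=> ab; rewrite -subr_gt0 -zrB zr_gt0 //; lia. Qed.

Lemma zr_neq0 a : ~~ Z.eqb a 0 -> zr a != 0.
Proof. by case: a => // a _; rewrite /zr /= intr_eq0; lia. Qed.

Definition vec (p : Z3) : 'rV[R]_3 := pt3 (zr p.1.1) (zr p.1.2) (zr p.2).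

Definition dot p q : R :=
  p 0 0 * q 0 0 + p 0 1 * q 0 1 + p 0 (2 : 'I_3) * q 0 (2 : 'I_3).

Lemma dot_vec (p q : Z3) : dot (vec p) (vec q) = zr (zdot p q).
Proof. by rewrite /dot !mxE /= !zrD !zrM. Qed.

Lemma vecB (p q : Z3) : vec p - vec q = vec (zsub p q).
Proof. by apply: rV3_eq; rewrite !mxE /= zrB. Qed.

Lemma det3E u v w : det3 u v w =
  u 0 0 * (v 0 1 * w 0 (2 : 'I_3) - v 0 (2 : 'I_3) * w 0 1) +
  u 0 1 * (v 0 (2 : 'I_3) * w 0 0 - v 0 0 * w 0 (2 : 'I_3)) +
  u 0 (2 : 'I_3) * (v 0 0 * w 0 1 - v 0 1 * w 0 0).
Proof.
rewrite /det3 (expand_det_row _ 0) !big_ord_recl big_ord0 /cofactor.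
rewrite !(expand_det_row _ 0) !big_ord_recl !big_ord0 /cofactor !det_mx11 !mxE /=.
have col (x : 'rV[R]_3) (i j : 'I_3) : val i = val j -> x 0 i = x 0 j.
  by move=> ij; congr (x 0 _); exact/val_inj.
repeat match goal with |- context [fun_of_matrix ?x _ (lift ?a ?b)] =>
  first [ rewrite (col x (lift a b) 0 erefl) | rewrite (col x (lift a b) 1 erefl)
        | rewrite (col x (lift a b) 2 erefl) ] end.
by rewrite -[ord0]/(0 : 'I_3) /bump /=; ring.
Qed.

Lemma det3_vec (u v w : Z3) : det3 (vec u) (vec v) (vec w) = zr (zdet u v w).
Proof. by rewrite det3E /zdet /zdot !mxE /= !(zrD, zrM, zrB). Qed.

Section Points.
Variable N : nat.
Implicit Types (P Q : 'M[R]_(N, 3)) (l m : 'rV[R]_N).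

Lemma dot_mulmx w l P : dot w (l *m P) = \sum_x l 0 x * dot w (row x P).
Proof.
rewrite /dot !mxE !mulr_sumr -!big_split /=; apply: eq_bigr => x _.
by rewrite !mxE; ring.
Qed.

Lemma dot_diff w l m P Q : \sum_x l 0 x = 1 -> \sum_x m 0 x = 1 ->
  dot w (l *m P) - dot w (m *m Q) =
  \sum_x \sum_y l 0 x * m 0 y * (dot w (row x P) - dot w (row y Q)).
Proof.
move=> l1 m1; rewrite !dot_mulmx.
transitivity (\sum_x \sum_y (l 0 x * dot w (row x P) * m 0 y -
    l 0 x * (m 0 y * dot w (row y Q)))).
  under [RHS]eq_bigr => x _ do rewrite sumrB -!mulr_sumr m1 mulr1.
  by rewrite sumrB -mulr_suml l1 mul1r.
by apply: eq_bigr => x _; apply: eq_bigr => y _; ring.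
Qed.

Definition barycentric l : Prop := (forall x, 0 <= l 0 x) /\ \sum_x l 0 x = 1.

Lemma separated w l m P Q (A B : pred 'I_N) : barycentric l -> barycentric m ->
  (forall x, l 0 x != 0 -> A x) -> (forall y, m 0 y != 0 -> B y) ->
  (forall x y, A x -> B y -> dot w (row y Q) < dot w (row x P)) ->
  dot w (m *m Q) < dot w (l *m P).
Proof.
move=> [l0 l1] [m0 m1] lA mB AB; rewrite -subr_gt0 dot_diff //.
have term0 x y : 0 <= l 0 x * m 0 y * (dot w (row x P) - dot w (row y Q)).
  have [->|/lA Ax] := eqVneq (l 0 x) 0; first by rewrite !mul0r.
  have [->|/mB By] := eqVneq (m 0 y) 0; first by rewrite mulr0 mul0r.
  by rewrite !mulr_ge0 // subr_ge0 ltW // AB.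
have pos l' : \sum_x l' 0 x = 1 -> (forall x, 0 <= l' 0 x) -> exists x : 'I_N, 0 < l' 0 x :> R.
  move=> s1 n0; apply/existsP; apply: contraT; rewrite negb_exists => /forallP H.
  move: s1; rewrite big1 => [/eqP|x _]; first by rewrite eq_sym oner_eq0.
  by apply/eqP; move: (H x); rewrite lt_def n0 andbT negbK.
have [x xp] := pos l l1 l0; have [y yp] := pos m m1 m0.
rewrite (bigD1 x) //= (bigD1 y) //= -addrA ltr_pwDl //.
  by rewrite !mulr_gt0 // subr_gt0 AB ?lA ?mB // gt_eqF.
by rewrite addr_ge0 // ?sumr_ge0 // => *; rewrite ?sumr_ge0.
Qed.

(** If the two points coincide, a sum of nonnegative terms over pairs of vertices is zero, so every
    pair with nonzero weights lies at the same level of w. *)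
Lemma weakly_separated w l m P (A B : pred 'I_N) : barycentric l -> barycentric m ->
  (forall x, l 0 x != 0 -> A x) -> (forall y, m 0 y != 0 -> B y) ->
  (forall x y, A x -> B y -> dot w (row y P) <= dot w (row x P)) ->
  l *m P = m *m P -> forall x y, l 0 x != 0 -> m 0 y != 0 ->
  dot w (row x P) = dot w (row y P).
Proof.
move=> [l0 l1] [m0 m1] lA mB AB e x y lx my.
have term0 (u v : 'I_N) : 0 <= l 0 u * m 0 v * (dot w (row u P) - dot w (row v P)).
  have [->|/lA Ax] := eqVneq (l 0 u) 0; first by rewrite !mul0r.
  have [->|/mB By] := eqVneq (m 0 v) 0; first by rewrite mulr0 mul0r.
  by rewrite !mulr_ge0 // subr_ge0 AB.
have : \sum_x \sum_y l 0 x * m 0 y * (dot w (row x P) - dot w (row y P)) = 0.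
  by rewrite -dot_diff // e subrr.
move/psumr_eq0P => /(_ (fun (u : 'I_N) _ => sumr_ge0 _ (fun (v : 'I_N) _ => term0 u v))) /(_ x isT).
move/psumr_eq0P => /(_ (fun (v : 'I_N) _ => term0 x v)) /(_ y isT) /eqP.
by rewrite !mulf_eq0 (negbTE lx) (negbTE my) /= subr_eq0 => /eqP.
Qed.

Lemma affinely_independent l m P (a b c : 'I_N) (v : 'rV[R]_3) :
  barycentric l -> barycentric m -> uniq [:: a; b; c] ->
  (forall x, l 0 x != 0 -> x \in [:: a; b; c]) ->
  (forall x, m 0 x != 0 -> x \in [:: a; b; c]) ->
  det3 (row b P - row a P) (row c P - row a P) v != 0 ->
  l *m P = m *m P -> l = m.
Proof.
move=> [_ l1] [_ m1] abc lS mS D e.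
have [d dE] : exists d, d = l - m by exists (l - m).
have dS x : x \notin [:: a; b; c] -> d 0 x = 0.
  move=> xS; rewrite dE !mxE.
  have -> : l 0 x = 0 by apply/eqP; apply: contraNT xS => /lS.
  have -> : m 0 x = 0 by apply/eqP; apply: contraNT xS => /mS.
  by rewrite subrr.
have sum3 (V : zmodType) (f : 'I_N -> V) : (forall x, x \notin [:: a; b; c] -> f x = 0) ->
    \sum_x f x = f a + f b + f c.
  move=> f0; rewrite (bigID (mem [:: a; b; c])) /= [X in _ + X]big1 // addr0.
  by rewrite -big_uniq //= !big_cons big_nil addr0 addrA.
have dsum : d 0 a + d 0 b + d 0 c = 0.
  rewrite -(sum3 _ (fun x => d 0 x)) //.
  by rewrite dE; under eq_bigr do rewrite !mxE; rewrite sumrB l1 m1 subrr.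
have dP : d 0 a *: row a P + d 0 b *: row b P + d 0 c *: row c P = 0.
  have -> : 0 = d *m P by rewrite dE mulmxBl e subrr.
  rewrite mulmx_sum_row (sum3 _ (fun x => d 0 x *: row x P)) //.
  by move=> x /dS ->; rewrite scale0r.
have dA : d 0 a = - d 0 b - d 0 c by lra.
have coord k : d 0 b * (P b k - P a k) + d 0 c * (P c k - P a k) = 0.
  have : (d 0 a *: row a P + d 0 b *: row b P + d 0 c *: row c P) 0 k = 0 by rewrite dP mxE.
  by rewrite !mxE dA => <-; ring.
move: D; rewrite det3E !mxE.
have := coord 0; have := coord 1; have := coord 2.
set b0 := P b 0 - _; set b1 := P b 1 - _; set b2 := P b 2 - _.
set c0 := P c 0 - _; set c1 := P c 1 - _; set c2 := P c 2 - _.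
set D := _ + _ + _ => e2 e1 e0 D0.
(* The vector d_b b + d_c c, with b and c taken relative to a, is zero. Its dot products with c x v
   and b x v are d_b D and - d_c D. *)
have db : d 0 b = 0.
  have : d 0 b * D = 0.
    have -> : d 0 b * D = (d 0 b * b0 + d 0 c * c0) * (c1 * v 0 2 - c2 * v 0 1) +
      (d 0 b * b1 + d 0 c * c1) * (c2 * v 0 0 - c0 * v 0 2) +
      (d 0 b * b2 + d 0 c * c2) * (c0 * v 0 1 - c1 * v 0 0) by rewrite /D; ring.
    by rewrite e0 e1 e2 !mul0r !addr0.
  by move/eqP; rewrite mulf_eq0 (negbTE D0) orbF => /eqP.
have dc : d 0 c = 0.
  have : d 0 c * D = 0.
    have -> : d 0 c * D = - ((d 0 b * b0 + d 0 c * c0) * (b1 * v 0 2 - b2 * v 0 1) +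
      (d 0 b * b1 + d 0 c * c1) * (b2 * v 0 0 - b0 * v 0 2) +
      (d 0 b * b2 + d 0 c * c2) * (b0 * v 0 1 - b1 * v 0 0)) by rewrite /D; ring.
    by rewrite e0 e1 e2 !mul0r !addr0 oppr0.
  by move/eqP; rewrite mulf_eq0 (negbTE D0) orbF => /eqP.
apply/eqP; rewrite -subr_eq0 -dE; apply/eqP/rowP => x; rewrite mxE.
have [|/dS //] := boolP (x \in [:: a; b; c]).
by rewrite !inE => /or3P[] /eqP -> //; rewrite dA db dc; lra.
Qed.

End Points.

End IntegerPoints.

(** * The Hopf annulus with a hole *)

Section Combinatorics.
Local Open Scope nat_scope.

Definition tri : Type := (nat * nat * nat)%type.

Definition tri_corners (t : tri) : seq nat := [:: t.1.1; t.1.2; t.2].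

Definition tri_sides (t : tri) : seq (nat * nat) :=
  [:: (t.1.1, t.1.2); (t.1.2, t.2); (t.2, t.1.1)].

Definition tri_adjacent (t u : tri) : bool :=
  has (fun e => (e.2, e.1) \in tri_sides u) (tri_sides t).

Definition code N (f : triangle N) : tri := (val f.1.1, val f.1.2, val f.2).

(** Combinatorial checks are computed on triples of natural numbers and carried back to triangles on
    'I_9; the two forms correspond for entries below 9. *)
Definition uncode (t : tri) : triangle 9 := (inord t.1.1, inord t.1.2, inord t.2).

Lemma codeK (f : triangle 9) : uncode (code f) = f.
Proof. by case: f => -[a b] c; rewrite /uncode /code /= !inord_val. Qed.

Lemma uncodeK (t : tri) : all (fun k => k < 9) (tri_corners t) -> code (uncode t) = t.
Proof.
by case: t => -[a b] c /and4P[/= ? ? ? _]; rewrite /uncode /code /= !inordK.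
Qed.

Lemma mem_corners N (x : 'I_N) (f : triangle N) :
  (x \in corners f) = (val x \in tri_corners (code f)).
Proof. by rewrite /corners !inE. Qed.

Lemma mem_sides N (e : 'I_N * 'I_N) (f : triangle N) :
  (e \in sides f) = ((val e.1, val e.2) \in tri_sides (code f)).
Proof. by case: e => x y; rewrite /sides !inE !xpair_eqE. Qed.

Lemma has_sides (f g : triangle 9) :
  has (fun e => opp_edge e \in sides g) (sides f) = tri_adjacent (code f) (code g).
Proof. by rewrite /tri_adjacent /= !mem_sides. Qed.

Variable faces : seq tri.

Definition surface_of : {set triangle 9} := [set f | code f \in faces].

(** A breadth-first search in n rounds. Its soundness is proved in general; that it finds all the
    required faces is read off from its computed value. *)
Definition reach (adj : rel tri) (n : nat) (t : tri) : seq tri :=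
  iter n (fun s => s ++ [seq u <- faces | (u \notin s) && has (fun v => adj v u) s]) [:: t].

Definition all_reached (adj : rel tri) (s : seq tri) : bool :=
  all (fun t => all (fun u => u \in reach adj (size faces) t) s) s.

Hypothesis faces9 : all (fun t => all (fun k => k < 9) (tri_corners t)) faces.

Lemma uncode_faces t : t \in faces -> uncode t \in surface_of.
Proof. by move=> tF; rewrite inE uncodeK //; exact: (allP faces9). Qed.

Lemma reach_faces adj n t u : t \in faces -> u \in reach adj n t -> u \in faces.
Proof.
move=> tF; elim: n u => [|n IH] u /=; first by rewrite inE => /eqP ->.
by rewrite mem_cat mem_filter => /orP[/IH //|/andP[]].
Qed.

Lemma reach_connect (e : rel (triangle 9)) (adj : rel tri) n t u :
  {in faces &, forall v w, adj v w -> e (uncode v) (uncode w)} ->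
  t \in faces -> u \in reach adj n t -> connect e (uncode t) (uncode u).
Proof.
move=> adje tF; elim: n u => [|n IH] u /=.
  by rewrite inE => /eqP ->; exact: connect0.
rewrite mem_cat mem_filter => /orP[/IH //|/andP[/andP[_ /hasP[v vr av]] uF]].
apply: connect_trans (IH _ vr) _; apply: connect1; apply: adje => //.
exact: reach_faces vr.
Qed.

Lemma surface_code f : f \in surface_of -> code f \in faces.
Proof. by rewrite inE. Qed.

Lemma surface_forall2 (p : tri -> tri -> bool) f g :
  all (fun t => all (p t) faces) faces ->
  f \in surface_of -> g \in surface_of -> p (code f) (code g).
Proof.
by move=> /allP H /surface_code fF /surface_code gF; exact: (allP (H _ fF)).
Qed.

Lemma adjacentE f g : adjacent surface_of f g =
  [&& f \in surface_of, g \in surface_of & tri_adjacent (code f) (code g)].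
Proof. by rewrite -has_sides. Qed.

Lemma uncodeK_faces t : t \in faces -> code (uncode t) = t.
Proof. by move=> tF; rewrite uncodeK //; exact: (allP faces9). Qed.

Definition oriented_check : bool :=
  [&& all (fun t => uniq (tri_corners t)) faces,
      all (fun t => all (fun u =>
        all (fun x => x \in tri_corners u) (tri_corners t) ==> (t == u)) faces) faces,
      all (fun t => all (fun u =>
        has (fun e => e \in tri_sides u) (tri_sides t) ==> (t == u)) faces) faces
    & all (fun x => all_reached
        (fun t u => [&& tri_adjacent t u, x \in tri_corners t & x \in tri_corners u])
        [seq t <- faces | x \in tri_corners t]) (iota 0 9)].

Lemma oriented_surface_of : oriented_check -> oriented_surface surface_of.
Proof.
case/and4P=> /allP H1 H2 H3 /allP H4; split.
- move=> f /surface_code /H1; rewrite -(map_inj_uniq val_inj).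
  by rewrite /corners /tri_corners.
- move=> f g fF gF fg; rewrite -[f]codeK -[g]codeK.
  have /implyP H := surface_forall2 H2 fF gF; congr uncode; apply/eqP/H.
  have E h : tri_corners (code h) = map val (corners h) by [].
  by apply/allP => x; rewrite !E => /mapP[y yf ->]; apply/map_f; rewrite -fg.
- move=> f g e fF gF ef eg; rewrite -[f]codeK -[g]codeK.
  have /implyP H := surface_forall2 H3 fF gF; congr uncode; apply/eqP/H.
  by apply/hasP; exists (val e.1, val e.2); rewrite -mem_sides.
- move=> x f g fF gF xf xg.
  have xI : val x \in iota 0 9 by rewrite mem_iota /=.
  have /allP := H4 _ xI => /(_ (code f)).
  rewrite mem_filter -mem_corners xf surface_code // => /(_ isT) /allP /(_ (code g)).
  rewrite mem_filter -mem_corners xg surface_code // => /(_ isT) H.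
  rewrite -[f]codeK -[g]codeK; apply: reach_connect H; last exact: surface_code.
  move=> v w vF wF /and3P[vw xv xw]; apply/and3P; split.
  - by rewrite adjacentE !uncode_faces // !uncodeK_faces.
  - by rewrite mem_corners uncodeK_faces.
  - by rewrite mem_corners uncodeK_faces.
Qed.

Lemma connected_surface_of : faces != [::] -> all_reached tri_adjacent faces ->
  connected_surface surface_of.
Proof.
move=> F0 /allP H; split.
  case: faces F0 uncode_faces => // t s _ /(_ t (mem_head _ _)) tF.
  by apply/set0Pn; exists (uncode t).
move=> f g fF gF; rewrite -[f]codeK -[g]codeK.
have /allP/(_ _ (surface_code gF)) R := H _ (surface_code fF).
apply: reach_connect R; last exact: surface_code.
by move=> v w vF wF vw; rewrite adjacentE !uncode_faces // !uncodeK_faces.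
Qed.

Definition boundary_sides : seq (nat * nat) :=
  [seq e <- flatten (map tri_sides faces) |
     all (fun t => (e.2, e.1) \notin tri_sides t) faces].

Lemma boundary_edgeP (e : 'I_9 * 'I_9) :
  boundary_edge surface_of e <-> (val e.1, val e.2) \in boundary_sides.
Proof.
rewrite mem_filter /=; split.
- case=> -[f fF ef] H; apply/andP; split.
    apply/allP => t tF; have := H _ (uncode_faces tF).
    by rewrite mem_sides uncodeK_faces.
  apply/flattenP; exists (tri_sides (code f)); last by rewrite -mem_sides.
  by apply/map_f/surface_code.
- case/andP=> /allP H /flattenP[s /mapP[t tF ->] et]; split.
    exists (uncode t); first exact: uncode_faces.
    by rewrite mem_sides uncodeK_faces.
  by move=> f /surface_code/H; rewrite mem_sides.
Qed.

End Combinatorics.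

(** The first five faces and (0, 1, 3) would form an annulus; (0, 1, 3) is replaced by six faces
    forming a collar between its sides and the hole (6, 7, 8). *)
Definition faces : seq tri :=
  [:: (5, 3, 1); (1, 2, 5); (4, 5, 2); (2, 0, 4); (3, 4, 0); (0, 1, 6); (1, 7, 6);
      (1, 3, 7); (3, 8, 7); (3, 0, 8); (0, 6, 8)]%N.

Lemma faces9 : all (fun t => all (fun k : nat => (k < 9)%N) (tri_corners t)) faces.
Proof. by []. Qed.

Lemma faces_oriented : oriented_check faces.
Proof. by vm_compute. Qed.

Lemma faces_connected : all_reached faces tri_adjacent faces.
Proof. by vm_compute. Qed.

Lemma faces_boundary : perm_eq (boundary_sides faces)
  [:: (0, 1); (1, 2); (2, 0); (3, 4); (4, 5); (5, 3); (6, 8); (8, 7); (7, 6)]%N.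
Proof. by vm_compute. Qed.

(* MathComp takes %Z for int. *)
Delimit Scope Z_scope with ZZ.

Definition z3 (s : seq Z3) (x : nat) : Z3 := nth (0, 0, 0)%ZZ s x.

(* The vertices 0, 1, 2 and 3, 4, 5 span the boundary of a Hopf annulus, and
   6, 7, 8 that of a hole in its face (0, 1, 3). The coordinates, the push-off and
   the separating functionals below were found by computer search. *)
Definition coords : seq Z3 :=
  [:: (-80, 0, 20); (80, 0, 20); (20, 0, -100); (0, -80, -20); (0, 20, -20);
      (20, 60, 80); (-20, -20, 10); (20, -20, 10); (0, -40, 0)]%ZZ.

Definition pushed_coords : seq Z3 :=
  [:: (-79, 2, 20); (83, -2, 18); (19, 1, -100); (4, -81, -21); (0, 21, -18);
      (20, 61, 82); (-21, -20, 9); (20, -19, 10); (0, -40, -1)]%ZZ.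

(** Faces may share vertices, so ties are allowed, but only between common vertices: a point of both
    faces is then carried by vertices that they share. *)
Definition separates (w : Z3) (t u : tri) : bool :=
  all (fun x => all (fun y =>
    let a := zdot w (z3 coords x) in let b := zdot w (z3 coords y) in
    Z.ltb b a || [&& Z.eqb a b, x \in tri_corners u & y \in tri_corners t])
    (tri_corners u)) (tri_corners t).

Definition separators : seq Z3 :=
  [:: (-1, 7, -2); (4, -1, 1); (2, 5, -1); (-4, 2, -7); (-1, -3, 2); (3, -2, 2);
      (2, -11, 15); (1, 0, 0); (1, 4, -2); (-1, 0, -3); (1, -2, 3); (1, -4, 6);
      (-1, 4, 0); (-1, 5, 0); (-1, 4, -2); (-1, 1, -4)]%ZZ.

Lemma faces_separated : all (fun t => all (fun u =>
  [|| t == u, has (fun w => separates w t u) separators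
    | has (fun w => separates w u t) separators]) faces) faces.
Proof. by vm_compute. Qed.

(* The push-off of t moves linearly to its final position, so that w, weakly
   separating t from u at the start and strictly at the end, does so strictly at
   every positive time. *)
Definition pushes (w : Z3) (t u : tri) : bool :=
  all (fun x => all (fun y =>
    Z.leb (zdot w (z3 coords y)) (zdot w (z3 coords x)) &&
    Z.ltb (zdot w (z3 coords y)) (zdot w (z3 pushed_coords x)))
    (tri_corners u)) (tri_corners t).

Definition push_separators : seq Z3 :=
  [:: (0, 1, -2); (1, 0, 2); (2, 3, -1); (-1, -3, 1); (1, -3, 4); (-1, 3, -1);
      (-6, 14, -5); (-3, -1, 1)]%ZZ.

Lemma faces_pushed : all (fun t => all (fun u =>
  has (fun w => pushes w t u) push_separators) faces) faces.
Proof. by vm_compute. Qed.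

Definition edge1 (t : tri) : Z3 := zsub (z3 coords t.1.2) (z3 coords t.1.1).
Definition edge2 (t : tri) : Z3 := zsub (z3 coords t.2) (z3 coords t.1.1).
Definition push (x : nat) : Z3 := zsub (z3 pushed_coords x) (z3 coords x).

Lemma pushed_positively : all (fun t => all (fun x =>
  Z.ltb 0 (zdet (edge1 t) (edge2 t) (push x))) (tri_corners t)) faces.
Proof. by vm_compute. Qed.

Definition view : Z3 := (-1, 2, -1)%ZZ.

(* From the direction [view], no vertex of one surface lies on the line through
   two vertices of the other. *)
Definition generic (s s' : seq Z3) : bool :=
  all (fun x => all (fun y => all (fun y' => (y == y') ||
    ~~ Z.eqb (zdet (zsub (z3 s' y') (z3 s' y)) (zsub (z3 s x) (z3 s' y)) view) 0)
    (iota 0 9)) (iota 0 9)) (iota 0 9).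

Lemma generic_view : generic coords pushed_coords && generic pushed_coords coords.
Proof. by vm_compute. Qed.

(** * Embedding, push-off and regular projection of the surface *)

Section Geometry.
Variable R : realType.

Definition points (s : seq Z3) : 'M[R]_(9, 3) := \matrix_(i < 9) vec R (z3 s i).

Lemma row_points s (x : 'I_9) : row x (points s) = vec R (z3 s x).
Proof. by rewrite rowK. Qed.

Notation P := (points coords).
Notation Q := (points pushed_coords).
Notation F := (surface_of faces).

Lemma realization_bary (l : 'rV[R]_9) : realization F l -> barycentric l.
Proof. by case. Qed.

(** By separation, the face of one of two coinciding points contains the support of the other. Both
    are then barycentric combinations over one nondegenerate triangle. *)
Lemma surface_embedded : embedded P F.
Proof.
move=> l m lF mF e; have bl := realization_bary lF; have bm := realization_bary mF.
have [_ _ [f fF lf]] := lF; have [_ _ [g gF mg]] := mF.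
have sep (w : Z3) (l' m' : 'rV[R]_9) (f' g' : triangle 9) : separates w (code f') (code g') ->
    barycentric l' -> barycentric m' -> (forall x, l' 0 x != 0 -> x \in corners f') ->
    (forall x, m' 0 x != 0 -> x \in corners g') -> l' *m P = m' *m P ->
    (forall x, m' 0 x != 0 -> x \in corners f') /\ (forall x, l' 0 x != 0 -> x \in corners g').
  move=> S bl' bm' lf' mg' e'.
  have pair x y : x \in corners f' -> y \in corners g' ->
      Z.ltb (zdot w (z3 coords y)) (zdot w (z3 coords x)) ||
      [&& Z.eqb (zdot w (z3 coords x)) (zdot w (z3 coords y)),
          x \in corners g' & y \in corners f'].
    rewrite !mem_corners => xf yg; exact: (allP (allP S _ xf) _ yg).
  have exists_pos (k : 'rV[R]_9) : barycentric k -> exists x, k 0 x != 0.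
    move=> [_ k1]; apply/existsP; apply: contraT; rewrite negb_exists => /forallP H.
    move: k1; rewrite big1 => [/eqP|x _]; first by rewrite eq_sym oner_eq0.
    by apply/eqP; move: (H x); rewrite negbK.
  have common x y : l' 0 x != 0 -> m' 0 y != 0 -> x \in corners g' /\ y \in corners f'.
    move=> lx my; have dxy := weakly_separated (w := vec R w) bl' bm' lf' mg' _ e' lx my.
    have := pair x y (lf' _ lx) (mg' _ my); case/orP=> [lt|/and3P[]//].
    have := dxy; rewrite !row_points !dot_vec => dE.
    have := zr_lt R lt; rewrite dE ?ltxx // => u v uf vg.
    case/orP: (pair u v uf vg) => [/(zr_lt R)/ltW|/and3P[/Z.eqb_eq uv _ _]];
      by rewrite !row_points !dot_vec // uv.
  have [x0 lx0] := exists_pos l' bl'; have [y0 my0] := exists_pos m' bm'.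
  split=> x nz; first by have [] := common _ _ lx0 nz.
  by have [] := common _ _ nz my0.
have mf x : m 0 x != 0 -> x \in corners f.
  have := surface_forall2 faces_separated fF gF.
  case/or3P=> [/eqP fg|/hasP[w _ S]|/hasP[w _ S]].
  - by move=> /mg; rewrite -[f]codeK -[g]codeK fg.
  - by have [+ _] := sep w l m f g S bl bm lf mg e; apply.
  - by have [_ +] := sep w m l g f S bm bl mg lf (esym e); apply.
have fc := surface_code fF.
(* The displacement of a corner by the push-off is transverse to the face, which certifies that the
   face is nondegenerate. *)
apply: (@affinely_independent _ _ l m P f.1.1 f.1.2 f.2 (vec R (push (val f.1.1)))) => //.
- by have [+ _ _ _] := oriented_surface_of faces9 faces_oriented; apply.
- rewrite !row_points !vecB det3_vec; apply/lt0r_neq0/zr_gt0.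
  exact: (allP (allP pushed_positively _ fc) _ (mem_head _ _)).
Qed.

Definition pushoff (t : R) (l : 'rV[R]_9) : 'rV[R]_3 := l *m P + t *: (l *m (Q - P)).

Lemma continuous_mulmx_row (M : 'M[R]_(9, 3)) : continuous (fun l : 'rV[R]_9 => l *m M).
Proof.
have -> : (fun l : 'rV[R]_9 => l *m M) = (fun l => \sum_x l 0 x *: row x M).
  by apply/funext => l; exact: mulmx_sum_row.
have c x : continuous (fun l : 'rV[R]_9 => l 0 x) by exact: coord_continuous.
elim: (index_enum _) => [|x s IH].
  under eq_fun do rewrite big_nil.
  exact: continuous_cst.
have -> : (fun l : 'rV[R]_9 => \sum_(y <- x :: s) l 0 y *: row y M) =
    (fun l => l 0 x *: row x M + \sum_(y <- s) l 0 y *: row y M).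
  by apply/funext => l; rewrite big_cons.
by apply: continuous_add IH; apply: continuous_scale; [exact: c|exact: continuous_cst].
Qed.

Lemma surface_pushoff : positive_pushoff P F Q.
Proof.
exists pushoff; split.
- apply: continuous_subspaceT; rewrite /pushoff.
  have c (M : 'M[R]_(9, 3)) : continuous (fun tl : R * 'rV[R]_9 => tl.2 *m M).
    apply: (@continuous_compose _ _ _ (fun tl : R * 'rV[R]_9 => tl.2) (fun l => l *m M)).
      exact: continuous_snd.
    exact: (@continuous_mulmx_row M).
  apply: continuous_add; first exact: c.
  by apply: continuous_scale; [exact: continuous_fst|exact: c].
- by move=> l _; rewrite /pushoff scale0r scale1r addr0 mulmxBr addrC subrK.
- move=> t l m t01 lF mF; have bl := realization_bary lF; have bm := realization_bary mF.
  have [_ _ [f fF lf]] := lF; have [_ _ [g gF mg]] := mF.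
  have /hasP[w _ S] := surface_forall2 faces_pushed fF gF.
  have -> : pushoff t l = l *m (P + t *: (Q - P)) by rewrite /pushoff [RHS]mulmxDr -scalemxAr.
  apply/eqP => e.
  have : dot (vec R w) (m *m P) < dot (vec R w) (l *m (P + t *: (Q - P))).
    apply: (separated bl bm lf mg) => x y; rewrite !mem_corners => xf yg.
    have /andP[/(zr_le R) le /(zr_lt R) lt] := allP (allP S _ xf) _ yg.
    have -> : row x (P + t *: (Q - P)) = (1 - t) *: row x P + t *: row x Q.
      by apply/rowP => k; rewrite !mxE; ring.
    have -> : dot (vec R w) ((1 - t) *: row x P + t *: row x Q) =
      (1 - t) * dot (vec R w) (row x P) + t * dot (vec R w) (row x Q).
      by rewrite /dot !mxE; ring.
    by rewrite !row_points !dot_vec; nra.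
  by rewrite e ltxx.
- move=> f l fF lF lpos; near=> t.
  have t0 : 0 < t by near: t; exact: nbhs_right_gt.
  have -> : pushoff t l - l *m P = t *: (l *m (Q - P)) by rewrite /pushoff addrC addKr.
  (* Linearity of the determinant in its last argument, through the cross product n of a and b,
     reduces positivity to the corners. *)
  have detE (a b : 'rV[R]_3) : det3 a b (t *: (l *m (Q - P))) =
      t * \sum_x l 0 x * det3 a b (row x (Q - P)).
    pose n := pt3 (a 0 1 * b 0 2 - a 0 2 * b 0 1) (a 0 2 * b 0 0 - a 0 0 * b 0 2)
      (a 0 0 * b 0 1 - a 0 1 * b 0 0).
    have dn p : det3 a b p = dot n p.
      by rewrite det3E /dot; have [-> -> ->] := pt3E (a 0 1 * b 0 2 - a 0 2 * b 0 1)
        (a 0 2 * b 0 0 - a 0 0 * b 0 2) (a 0 0 * b 0 1 - a 0 1 * b 0 0); ring.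
    rewrite dn scalemxAl dot_mulmx mulr_sumr; apply: eq_bigr => x _.
    by rewrite dn mxE mulrA.
  rewrite detE.
  have fc := surface_code fF; have [l0 l1 [g gF lg]] := lF.
  apply: mulr_gt0 => //.
  have term x : x \in corners f -> 0 < det3 (row f.1.2 P - row f.1.1 P) (row f.2 P - row f.1.1 P) (row x (Q - P)).
    rewrite mem_corners => xf; rewrite linearB /= !row_points !vecB det3_vec; apply: zr_gt0.
    exact: (allP (allP pushed_positively _ fc) _ xf).
  rewrite (bigD1 f.1.1) //= ltr_pwDl //.
    by rewrite mulr_gt0 ?lpos ?term // /corners inE eqxx.
  apply: sumr_ge0 => x _; have [xf|xf] := boolP (x \in corners f).
    by rewrite mulr_ge0 // ltW // term.
  (* All corners of f have positive weight, so the face g supporting l must be f itself. *)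
  suff -> : l 0 x = 0 by rewrite mul0r.
  apply/eqP; apply: contraNT xf => /lg; have /and4P[_ C _ _] := faces_oriented.
  have /implyP E := surface_forall2 C fF gF.
  rewrite -[f]codeK -[g]codeK (eqP (E _)) //.
  apply/allP => y; rewrite -[tri_corners (code f)]/(map val (corners f)) => /mapP[z zf ->].
  by rewrite -mem_corners; apply: lg; rewrite gt_eqF // lpos.
Unshelve. all: end_near. Qed.

Lemma view_regular (c d : 'M[int]_9) (s s' : seq Z3) : generic s s' && generic s' s ->
  (forall x, c x x = 0) -> (forall x, d x x = 0) ->
  regular_direction (points s) c (points s') d (vec R view).
Proof.
case/andP=> G G' c0 d0; split.
  apply/eqP => /rowP /(_ 0); rewrite !mxE /= => /eqP.
  by apply/negP/(zr_neq0 R).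
have key (u u' : seq Z3) (x y y' : 'I_9) (t h : R) : generic u u' -> y != y' ->
    row x (points u) != (1 - t) *: row y (points u') + t *: row y' (points u') + h *: vec R view.
  move=> Guu yy; apply/eqP => e.
  have : zr R (zdet (zsub (z3 u' y') (z3 u' y)) (zsub (z3 u x) (z3 u' y)) view) != 0.
    apply: zr_neq0.
    have I (z : 'I_9) : val z \in iota 0 9 by rewrite mem_iota /=.
    have := allP (allP (allP Guu _ (I x)) _ (I y)) _ (I y').
    by rewrite val_eqE (negbTE yy).
  rewrite -det3_vec -!vecB -!(row_points) e det3E !mxE => /eqP; apply; ring.
move=> x x' y y' cxx dyy t h _; split.
- by apply: key => //; apply: contra_neq dyy => ->.
- by apply: key => //; apply: contra_neq cxx => ->.
Qed.

End Geometry.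

(** * First homology of the surface *)

Definition arrow (a b x y : nat) : int :=
  ((x == a) && (y == b))%:Z - ((x == b) && (y == a))%:Z.

Definition sum_list (T : Type) (s : seq T) (f : T -> int) : int :=
  foldr (fun x r => f x + r) 0 s.

Definition chain_of (s : seq (nat * nat)) (x y : nat) : int :=
  sum_list s (fun e => arrow e.1 e.2 x y).

(** The surface is a sphere with three holes; two of its boundary curves freely generate the
    homology. *)
Definition cycles : seq (seq (nat * nat)) :=
  [:: [:: (0, 1); (1, 2); (2, 0)]; [:: (6, 8); (8, 7); (7, 6)]]%N.

Definition tree_path : seq (seq (nat * nat)) :=
  [:: [::]; [:: (0, 1)]; [:: (0, 2)]; [:: (0, 3)]; [:: (0, 4)]; [:: (0, 1); (1, 5)];
      [:: (0, 6)]; [:: (0, 1); (1, 7)]; [:: (0, 8)]]%N.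

(* The loop which follows the spanning tree from 0 to x, the edge xy, and the tree back
   to 0, is a combination of the cycles and of the boundaries of the faces; the
   table lists its coefficients when they are not all zero. *)
Definition loop_table : seq ((nat * nat) * seq int * seq int) :=
  [:: ((1, 2)%N, [:: 1; 0], [:: 0; 0; 0; 0; 0; 0; 0; 0; 0; 0; 0]);
      ((1, 3)%N, [:: 0; -1], [:: 0; 0; 0; 0; 0; 1; 1; 1; 1; 1; 1]);
      ((1, 6)%N, [:: 0; 0], [:: 0; 0; 0; 0; 0; 1; 0; 0; 0; 0; 0]);
      ((2, 4)%N, [:: 0; 0], [:: 0; 0; 0; -1; 0; 0; 0; 0; 0; 0; 0]);
      ((2, 5)%N, [:: -1; 0], [:: 0; 1; 0; 0; 0; 0; 0; 0; 0; 0; 0]);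
      ((3, 4)%N, [:: 0; 0], [:: 0; 0; 0; 0; 1; 0; 0; 0; 0; 0; 0]);
      ((3, 5)%N, [:: 0; 1], [:: -1; 0; 0; 0; 0; -1; -1; -1; -1; -1; -1]);
      ((3, 7)%N, [:: 0; 1], [:: 0; 0; 0; 0; 0; -1; -1; 0; -1; -1; -1]);
      ((3, 8)%N, [:: 0; 0], [:: 0; 0; 0; 0; 0; 0; 0; 0; 0; -1; 0]);
      ((4, 5)%N, [:: -1; 0], [:: 0; 1; 1; 1; 0; 0; 0; 0; 0; 0; 0]);
      ((6, 7)%N, [:: 0; 0], [:: 0; 0; 0; 0; 0; -1; -1; 0; 0; 0; 0]);
      ((6, 8)%N, [:: 0; 0], [:: 0; 0; 0; 0; 0; 0; 0; 0; 0; 0; 1]);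
      ((7, 8)%N, [:: 0; -1], [:: 0; 0; 0; 0; 0; 1; 1; 0; 0; 0; 1])].

(** A pair outside the table yields empty lists, whose coefficients all read as 0: this covers the
    edges of the tree. *)
Definition loop_row (x y : nat) : seq int * seq int :=
  nth ([::], [::]) [seq (r.1.2, r.2) | r <- loop_table] (index (x, y) [seq r.1.1 | r <- loop_table]).

Definition cycle_coef (i x y : nat) : int := nth 0 (loop_row x y).1 i.

Definition face_coef (t : tri) (x y : nat) : int := nth 0 (loop_row x y).2 (index t faces).

Definition vertices : seq nat := iota 0 9.

Definition is_edge (x y : nat) : bool :=
  has (fun t => (x \in tri_corners t) && (y \in tri_corners t)) faces.

Definition loops_check : bool :=
  all (fun x => all (fun y => (x < y)%N && is_edge x y ==>
    all (fun p => all (fun q =>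
      arrow x y p q + chain_of (nth [::] tree_path x) p q - chain_of (nth [::] tree_path y) p q ==
      sum_list (iota 0 2) (fun i => cycle_coef i x y * chain_of (nth [::] cycles i) p q) +
      sum_list faces (fun t => face_coef t x y * chain_of (tri_sides t) p q))
    vertices) vertices) vertices) vertices.

Lemma loops_checked : loops_check.
Proof. by vm_compute. Qed.

(** The table of coefficients used as a cochain. It is a cocycle dual to [cycles], and so reads off
    the coordinates of a homology class. *)
Definition period (i : nat) (g : nat -> nat -> int) : int :=
  sum_list vertices (fun x => sum_list vertices (fun y =>
    if (x < y)%N then cycle_coef i x y * g x y else 0)).

Lemma periods_checked :
  all (fun i => all (fun t => period i (chain_of (tri_sides t)) == 0) faces &&
    all (fun j => period i (chain_of (nth [::] cycles j)) == (i == j)%:Z) (iota 0 2)) (iota 0 2).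
Proof. by vm_compute. Qed.

Lemma cycles_checked :
  all (fun c => all (fun x => (sum_list vertices (chain_of c x) == 0) &&
    all (fun y => (chain_of c y x == - chain_of c x y) &&
      ((chain_of c x y != 0) ==> is_edge x y)) vertices) vertices) cycles.
Proof. by vm_compute. Qed.

Lemma sum_listE (T : Type) (s : seq T) (f : T -> int) :
  sum_list s f = \sum_(x <- s) f x.
Proof. by rewrite unlock. Qed.

Lemma sum_vertices (f : nat -> int) : sum_list vertices f = \sum_(x < 9) f x.
Proof. by rewrite sum_listE -(big_mkord xpredT). Qed.

Lemma vertex_in (x : 'I_9) : val x \in vertices.
Proof. by rewrite mem_iota /=. Qed.

Definition chain_mx (g : nat -> nat -> int) : 'M[int]_9 := \matrix_(x < 9, y < 9) g x y.

Definition H1_cycle (i : 'I_2) : 'M[int]_9 := chain_mx (chain_of (nth [::] cycles i)).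

Notation F := (surface_of faces).

Lemma is_edgeP (x y : 'I_9) :
  reflect (exists2 f, f \in F & (x \in corners f) && (y \in corners f)) (is_edge x y).
Proof.
apply: (iffP hasP) => -[t tF xyt].
  exists (uncode t); first by apply: uncode_faces tF; exact: faces9.
  by rewrite !mem_corners (uncodeK_faces faces9).
by exists (code t); [exact: surface_code|rewrite -!mem_corners].
Qed.

Lemma H1_cycle_is_cycle i : is_cycle F (H1_cycle i).
Proof.
have iI : nth [::] cycles i \in cycles by apply: mem_nth; case: i.
have /allP C := allP cycles_checked _ iI.
split.
- move=> x y; rewrite !mxE; have /andP[_ /allP/(_ _ (vertex_in y))] := C _ (vertex_in x).
  by case/andP=> /eqP.
- move=> x y; rewrite mxE; have /andP[_ /allP/(_ _ (vertex_in y))] := C _ (vertex_in x).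
  by case/andP=> _ /implyP H /H /is_edgeP.
- move=> x; have /andP[/eqP + _] := C _ (vertex_in x).
  by rewrite sum_vertices => e; rewrite -[RHS]e; apply: eq_bigr => y _; rewrite mxE.
Qed.

Lemma triangle_boundaryE (f : triangle 9) :
  triangle_boundary f = chain_mx (chain_of (tri_sides (code f))).
Proof.
apply/matrixP => x y; rewrite mxE /chain_of sum_listE /triangle_boundary summxE.
rewrite /sides /tri_sides !big_cons !big_nil /arrow /code /= !mxE.
by rewrite !natz.
Qed.

Lemma sum_surface (V : zmodType) (G : triangle 9 -> V) :
  \sum_(f in F) G f = \sum_(t <- faces) G (uncode t).
Proof.
rewrite -(big_map uncode xpredT) [RHS]big_uniq.
  apply: eq_bigl => f; rewrite inE; apply/idP/mapP => [fF|[t tF ->]].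
    by exists (code f) => //; rewrite codeK.
  by rewrite (uncodeK_faces faces9).
rewrite map_inj_in_uniq //.
by apply: can_in_inj => t tF; exact: (uncodeK_faces faces9).
Qed.

(** Passes between sums over unordered and ordered pairs. With T x y = [delta_mx x y] the sum
    rebuilds c; with T depending on x alone, the sums of the rows of c factor out. *)
Lemma antisymmetric_sum (c : 'M[int]_9) (V : lmodType int) (T : 'I_9 -> 'I_9 -> V) :
  (forall x y, c y x = - c x y) ->
  \sum_(x < 9) \sum_(y < 9 | (x < y)%N) c x y *: (T x y - T y x) =
  \sum_x \sum_y c x y *: T x y.
Proof.
move=> ac; transitivity (\sum_(x < 9) \sum_(y < 9 | (x < y)%N) c x y *: T x y +
  \sum_(x < 9) \sum_(y < 9 | (y < x)%N) c x y *: T x y).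
  rewrite [X in _ = _ + X](exchange_big_dep xpredT) //= -big_split /=; apply: eq_bigr => x _.
  rewrite -big_split /=; apply: eq_bigr => y _.
  by rewrite scalerBr (ac x y) scaleNr.
rewrite -big_split /=; apply: eq_bigr => x _.
rewrite [RHS](bigID (fun y : 'I_9 => (x < y)%N)) /=; congr (_ + _).
rewrite [RHS](bigID (fun y : 'I_9 => (y < x)%N)) /= [X in _ = _ + X]big1 ?addr0.
  by apply: eq_bigl => y; lia.
move=> y /andP[xy yx]; have -> : y = x by apply/val_inj => /=; lia.
have : c x x = 0 by have := ac x x; lia.
by move=> ->; rewrite scale0r.
Qed.

Lemma arrow_mx (x y : 'I_9) : chain_mx (arrow x y) = delta_mx x y - delta_mx y x.
Proof. by apply/matrixP => p q; rewrite !mxE /arrow !val_eqE !natz. Qed.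

Definition tree_mx (x : nat) : 'M[int]_9 := chain_mx (chain_of (nth [::] tree_path x)).

Definition face_mx (t : tri) : 'M[int]_9 := chain_mx (chain_of (tri_sides t)).

Lemma loop_decomposition (x y : 'I_9) : (x < y)%N -> is_edge x y ->
  chain_mx (arrow x y) + tree_mx x - tree_mx y =
  \sum_(i < 2) cycle_coef i x y *: H1_cycle i + \sum_(t <- faces) face_coef t x y *: face_mx t.
Proof.
move=> xy xyE; apply/matrixP => p q.
have := allP (allP loops_checked _ (vertex_in x)) _ (vertex_in y).
rewrite xy xyE => /implyP/(_ isT) H; have /eqP := allP (allP H _ (vertex_in p)) _ (vertex_in q).
rewrite !sum_listE !mxE => ->.
rewrite !summxE; congr (_ + _); last by apply: eq_bigr => t _; rewrite !mxE.
by rewrite -[iota 0 2]/(index_iota 0 2) big_mkord; apply: eq_bigr => i _; rewrite !mxE.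
Qed.

(** Each edge is closed into a loop by paths of the tree. The added paths cancel in total, because a
    cycle has zero sum at each vertex. *)
Lemma cycle_decomposition (c : 'M[int]_9) : is_cycle F c ->
  c = \sum_(x < 9) \sum_(y < 9 | (x < y)%N) c x y *:
    (\sum_(i < 2) cycle_coef i x y *: H1_cycle i + \sum_(t <- faces) face_coef t x y *: face_mx t).
Proof.
move=> [ac cS c0].
have T0 : \sum_(x < 9) \sum_(y < 9 | (x < y)%N) c x y *: (tree_mx x - tree_mx y) = 0.
  rewrite (antisymmetric_sum (fun x _ => tree_mx x)) // big1 // => x _.
  by rewrite -scaler_suml c0 scale0r.
have cE : c = \sum_(x < 9) \sum_(y < 9 | (x < y)%N) c x y *: (delta_mx x y - delta_mx y x) +
    \sum_(x < 9) \sum_(y < 9 | (x < y)%N) c x y *: (tree_mx x - tree_mx y).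
  rewrite T0 addr0 (antisymmetric_sum (fun x y => delta_mx x y)) //.
  exact: matrix_sum_delta.
rewrite [LHS]cE -big_split /=; apply: eq_bigr => x _.
rewrite -big_split /=; apply: eq_bigr => y xy.
rewrite -scalerDr -arrow_mx addrA.
have [->|cxy] := eqVneq (c x y) 0; first by rewrite !scale0r.
by rewrite loop_decomposition //; apply/is_edgeP/cS.
Qed.

Definition period_mx (i : 'I_2) (M : 'M[int]_9) : int :=
  \sum_(x < 9) \sum_(y < 9 | (x < y)%N) cycle_coef i x y * M x y.

Lemma period_mxE i g : period_mx i (chain_mx g) = period i g.
Proof.
rewrite /period sum_vertices; apply: eq_bigr => x _; rewrite sum_vertices.
by rewrite [RHS]big_mkcond /= big_mkcond; apply: eq_bigr => y _; rewrite mxE; case: ifP.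
Qed.

Lemma period_mx_sum i (I : Type) (s : seq I) (P : pred I) (a : I -> int) (M : I -> 'M[int]_9) :
  period_mx i (\sum_(k <- s | P k) a k *: M k) = \sum_(k <- s | P k) a k * period_mx i (M k).
Proof.
rewrite /period_mx; under [RHS]eq_bigr do rewrite mulr_sumr.
rewrite [RHS]exchange_big /=; apply: eq_bigr => x _.
under [RHS]eq_bigr do rewrite mulr_sumr.
rewrite [RHS]exchange_big /=; apply: eq_bigr => y _.
by rewrite summxE mulr_sumr; apply: eq_bigr => k _; rewrite mxE; ring.
Qed.

Lemma period_mxB i M M' : period_mx i (M - M') = period_mx i M - period_mx i M'.
Proof.
rewrite /period_mx -sumrB; apply: eq_bigr => x _; rewrite -sumrB.
by apply: eq_bigr => y _; rewrite !mxE mulrBr.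
Qed.

Lemma ord2_in (i : 'I_2) : val i \in iota 0 2.
Proof. by rewrite mem_iota /=. Qed.

Lemma period_face i f : f \in F -> period_mx i (triangle_boundary f) = 0.
Proof.
move=> fF; rewrite triangle_boundaryE period_mxE.
have /andP[/allP H _] := allP periods_checked _ (ord2_in i).
by apply/eqP/H/surface_code.
Qed.

Lemma period_cycle i j : period_mx i (H1_cycle j) = (i == j)%:Z.
Proof.
rewrite period_mxE; have /andP[_ /allP H] := allP periods_checked _ (ord2_in i).
exact/eqP/H/ord2_in.
Qed.

(** The loops give the coordinates of a cycle; the periods, zero on boundaries of faces and dual to
    the cycles, show that they are unique. *)
Lemma surface_H1_basis : H1_basis F H1_cycle.
Proof.
split=> [i|c cF]; first exact: H1_cycle_is_cycle.
pose a : 'rV[int]_2 := \row_i \sum_(x < 9) \sum_(y < 9 | (x < y)%N) c x y * cycle_coef i x y.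
exists a; split=> [|a' [e cE]].
  exists (fun f => \sum_(x < 9) \sum_(y < 9 | (x < y)%N) c x y * face_coef (code f) x y).
  rewrite sum_surface /= {1}(cycle_decomposition cF).
  apply: (canLR (addrK _)); rewrite addrC.
  transitivity (\sum_(i < 2) (\sum_(x < 9) \sum_(y < 9 | (x < y)%N) c x y * cycle_coef i x y) *: H1_cycle i +
    \sum_(t <- faces) (\sum_(x < 9) \sum_(y < 9 | (x < y)%N) c x y * face_coef t x y) *: face_mx t).
    under [X in _ = X + _]eq_bigr do rewrite scaler_suml.
    under [X in _ = _ + X]eq_bigr do rewrite scaler_suml.
    rewrite [X in _ = X + _]exchange_big [X in _ = _ + X]exchange_big -big_split /=.
    apply: eq_bigr => x _.
    under [X in _ = X + _]eq_bigr do rewrite scaler_suml.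
    under [X in _ = _ + X]eq_bigr do rewrite scaler_suml.
    rewrite [X in _ = X + _]exchange_big [X in _ = _ + X]exchange_big -big_split /=.
    apply: eq_bigr => y _.
    by rewrite scalerDr !scaler_sumr; congr (_ + _); apply: eq_bigr => k _; rewrite scalerA.
  congr (_ + _); first by apply: eq_bigr => i _; rewrite mxE.
  rewrite [LHS]big_seq [RHS]big_seq; apply: eq_bigr => t tF.
  by rewrite triangle_boundaryE (uncodeK_faces faces9).
apply/rowP => i; rewrite mxE.
have : period_mx i (c - \sum_i a' 0 i *: H1_cycle i) = 0.
  by rewrite cE period_mx_sum big1 // => f fF; rewrite period_face ?mulr0.
rewrite period_mxB period_mx_sum (bigD1 i) //= period_cycle eqxx mulr1 big1 => [|j ji].
  rewrite addr0 => /eqP; rewrite subr_eq0 => /eqP <-.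
  by apply: eq_bigr => x _; apply: eq_bigr => y _; rewrite mulrC.
by rewrite period_cycle eq_sym (negbTE ji) mulr0.
Qed.

(** * The two numberings of its boundary *)

Definition boundary_curves : seq (seq nat) :=
  [:: [:: 0; 1; 2]; [:: 3; 4; 5]; [:: 6; 8; 7]]%N.

Definition boundary_vertex (k m : nat) : nat := nth 0%N (nth [::] boundary_curves k) m.

Definition next3 (m : nat) : nat := (m.+1 %% 3)%N.

(** * Parity of the linking number of the Hopf pair *)

Section Example.
Variable R : realType.

Notation P := (points R coords).
Notation F := (surface_of faces).

Definition polygon (k : nat) : seq 'rV[R]_3 :=
  [seq vec R (z3 coords x) | x <- nth [::] boundary_curves k].

Lemma size_polygon k : (k < 3)%N -> size (polygon k) = 3%N.
Proof. by case: k => [|[|[|k]]]. Qed.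

Lemma vertex_polygon k (m : nat) : (k < 3)%N -> (m < 3)%N ->
  vertex (polygon k) m = vec R (z3 coords (boundary_vertex k m)).
Proof.
move=> k3 m3; rewrite /vertex size_polygon // modz_small; last by lia.
by rewrite /polygon (nth_map 0%N) //; case: k k3 => [|[|[|k]]].
Qed.

Lemma vertex_polygonS k (m : nat) : (k < 3)%N -> (m < 3)%N ->
  vertex (polygon k) (m%:Z + 1) = vec R (z3 coords (boundary_vertex k (next3 m))).
Proof.
move=> k3 m3; rewrite -vertex_polygon ?ltn_pmod // /next3.
have e := vertexD (polygon k) ((m.+1 %% 3)%N : int) ((m.+1 %/ 3)%N : int).
rewrite -e size_polygon //; congr (vertex _ _).
by rewrite -PoszM -PoszD addnC -divn_eq -addn1 PoszD.
Qed.

Lemma zr_Zneg p : zr R (Z.neg p) = - (Pos.to_nat p)%:R.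
Proof.
rewrite /zr /= NegzE intrN prednK; last by lia.
by [].
Qed.

Lemma curve_polygon k (m : nat) (r : R) : (k < 3)%N -> (m < 3)%N -> 0 <= r <= 1 ->
  curve (polygon k) (m%:R + r) =
  (1 - r) *: vec R (z3 coords (boundary_vertex k m)) +
  r *: vec R (z3 coords (boundary_vertex k (next3 m))).
Proof.
move=> k3 m3 r01; rewrite (@curve_edge _ _ m%:Z); last by rewrite intrD -pmulrn; lra.
by rewrite vertex_polygon // vertex_polygonS // -pmulrn addrAC subrr add0r.
Qed.

Lemma square_missing (k a b c d : nat) : k \in [:: 1; 2; 3]%N ->
  k \notin [:: a; b; c; d] -> square a b c d = false.
Proof.
move=> k3; rewrite !inE !negb_or => /and4P[ka kb kc kd].
have full_mem u v w : full_triangle u v w -> k \in [:: u; v; w].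
  by move=> /perm_mem ->.
rewrite /square.
have [/full_mem|_] := boolP (full_triangle a b d).
  by rewrite !inE (negbTE ka) (negbTE kb) (negbTE kd).
have [/full_mem|_ //] := boolP (full_triangle a c d).
by rewrite !inE (negbTE ka) (negbTE kc) (negbTE kd).
Qed.

Lemma vec_coords :
  (vec R (z3 coords 0) = pt3 (-80) 0 20) * (vec R (z3 coords 1) = pt3 80 0 20) *
  (vec R (z3 coords 2) = pt3 20 0 (-100)) * (vec R (z3 coords 3) = pt3 0 (-80) (-20)) *
  (vec R (z3 coords 4) = pt3 0 20 (-20)) * (vec R (z3 coords 5) = pt3 20 60 80) *
  (vec R (z3 coords 6) = pt3 (-20) (-20) 10) * (vec R (z3 coords 7) = pt3 20 (-20) 10) *
  (vec R (z3 coords 8) = pt3 0 (-40) 0).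
Proof. by do ! split; rewrite /vec /= ?zr_Zneg. Qed.

Ltac coordinates := rewrite !curve_polygon //= !vec_coords !mxE /=.

Definition hopf_label (e e' : nat) (r r' : R) : nat :=
  label (curve (polygon 0) (e%:R + r) - curve (polygon 1) (e'%:R + r')).

(** Only the first edges of the two curves cross with the right one above; on any other pair of
    edges one label is absent and no triangle is full. *)
Lemma hopf_label_missing (e e' : nat) : (e < 3)%N -> (e' < 3)%N -> (e, e') != (0, 0)%N ->
  exists2 k, k \in [:: 1; 2; 3]%N &
    forall r r' : R, 0 <= r <= 1 -> 0 <= r' <= 1 -> hopf_label e e' r r' != k.
Proof.
move=> e3 e3' ee.
have lab (v : 'rV[R]_3) (k : nat) : (k \in [:: 1; 2; 3])%N ->
    ((k = 1%N -> v 0 (2 : 'I_3) <= 0 \/ v 0 0 <= 0) /\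
     (k = 2%N -> v 0 (2 : 'I_3) <= 0 \/ 0 < v 0 0 \/ v 0 1 <= 0) /\
     (k = 3%N -> v 0 (2 : 'I_3) <= 0 \/ 0 < v 0 0 \/ 0 < v 0 1)) -> label v != k.
  rewrite /label !inE => /or3P[] /eqP -> [H1 [H2 H3]].
  - by have := H1 erefl; do 3? case: ifP => //=; lra.
  - by have := H2 erefl; do 3? case: ifP => //=; lra.
  - by have := H3 erefl; do 3? case: ifP => //=; lra.
case: e' e3' ee => [|[|[|e']]] // _; case: e e3 => [|[|[|e]]] // _ _.
- exists 2%N => // r r' r01 r01'; apply: lab => //; split => //; split => // _.
  by coordinates; lra.
- exists 1%N => // r r' r01 r01'; apply: lab => //; split => // _.
  (* The third coordinate 120 r - 80 is nonpositive up to r = 2/3, and beyond that the first one, 20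
     - 100 r, is negative. *)
  by coordinates; have [?|?] := leP r (2 / 3); [left|right]; lra.
- exists 2%N => // r r' r01 r01'; apply: lab => //; split => //; split => // _.
  by coordinates; right; right; lra.
- exists 2%N => // r r' r01 r01'; apply: lab => //; split => //; split => // _.
  by coordinates; right; right; lra.
- exists 2%N => // r r' r01 r01'; apply: lab => //; split => //; split => // _.
  by coordinates; right; right; lra.
- exists 3%N => // r r' r01 r01'; apply: lab => //; split => //; split => // _.
  (* The first curve has height at most 20, and this edge of the second has height 80 - 100 r', at
     least 20 up to r' = 3/5; beyond that the second coordinate 140 r' - 60 is positive. The next
     two cases are alike. *)
  by coordinates; have [?|?] := leP r' (3 / 5); [left|right; right]; lra.
- exists 3%N => // r r' r01 r01'; apply: lab => //; split => //; split => // _.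
  by coordinates; have [?|?] := leP r' (3 / 5); [left|right; right]; lra.
- exists 3%N => // r r' r01 r01'; apply: lab => //; split => //; split => // _.
  by coordinates; have [?|?] := leP r' (3 / 5); [left|right; right]; lra.
Qed.

(** Here the difference is (160 r - 80, 80 - 100 r', 40), which meets the positive z-axis only at r
    = 1/2, r' = 4/5. *)
Lemma hopf_label00 (r r' : R) : 0 <= r <= 1 -> 0 <= r' <= 1 ->
  hopf_label 0 0 r r' = if 1 < 2 * r then 1%N else if 5 * r' < 4 then 2%N else 3%N.
Proof.
move=> r01 r01'; rewrite /hopf_label /label; coordinates.
rewrite ifF; last by apply/negbTE; rewrite -ltNge; lra.
rewrite [X in if X then _ else _](_ : _ = (1 < 2 * r)); last by apply/idP/idP; lra.
by case: ifP => // _; rewrite [X in if X then _ else _](_ : _ = (5 * r' < 4)) //; apply/idP/idP; lra.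
Qed.

Lemma crossing_cell (m : nat) : (0 < m)%N -> exists i0 j0,
  [/\ (i0 < m)%N, (j0 < m)%N, (2 * i0 <= m < 2 * i0.+1)%N &
      (5 * j0 < 4 * m <= 5 * j0.+1)%N].
(* The cell around (1/2, 4/5). Points with r = 1/2 do not get label 1, nor points with r' = 4/5
   label 2, whence the predecessor in the second quotient only. *)
Proof. by move=> m0; exists (m %/ 2)%N, ((4 * m).-1 %/ 5)%N; split; lia. Qed.

(** The corners of the crossing cell are labelled 2, 1, 3, 1, so that just one of its two triangles
    is full; every other cell misses one of the labels 1, 2, 3. *)
Lemma crossing_square (m i0 j0 i j : nat) :
  (2 * i0 <= m < 2 * i0.+1)%N -> (5 * j0 < 4 * m <= 5 * j0.+1)%N ->
  let l u v := if (m < 2 * u)%N then 1%N else if (5 * v < 4 * m)%N then 2%N else 3%N in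
  square (l i j) (l i.+1 j) (l i j.+1) (l i.+1 j.+1) = (i == i0) && (j == j0).
Proof.
move=> hi hj l; rewrite /l.
have [a1|a1] := ltnP m (2 * i); have [a2|a2] := ltnP m (2 * i.+1);
have [b1|b1] := ltnP (5 * j) (4 * m); have [b2|b2] := ltnP (5 * j.+1) (4 * m);
  rewrite /square /full_triangle /=; try lia;
  ((rewrite [perm_eq _ _](_ : _ = false); last by []) || (rewrite [perm_eq _ _](_ : _ = true); last by [])); lia.
Qed.

(* With m steps per edge, the subdivided torus has a single full triangle, in the
   square where the first edges of both curves cross. *)
Lemma hopf_degree (m : nat) : (0 < m)%N ->
  degree_mod2 (3 * m) (curve_difference (polygon 0) (polygon 1)).
Proof.
move=> m0; pose l i j := label (curve_difference (polygon 0) (polygon 1)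
  (i%:R / (3 * m)%:R) (j%:R / (3 * m)%:R)).
have mR : (m%:R : R) != 0 by rewrite pnatr_eq0; lia.
pose r i e : R := i%:R / m%:R - e%:R.
have r01 i e : (e * m <= i <= e.+1 * m)%N -> 0 <= r i e <= 1.
  move=> /andP[ei ie]; rewrite /r subr_ge0 lerBlDr ler_pdivlMr ?ler_pdivrMr ?ltr0n //.
  by rewrite nat1r -!natrM !ler_nat ei.
have lE i j e e' : l i j = hopf_label e e' (r i e) (r j e').
  rewrite /l /hopf_label /curve_difference !size_polygon // natrM.
  have d k : 3 * (k%:R / (3 * m%:R)) = k%:R / m%:R :> R by field.
  by rewrite !d /r !(addrC _%:R) !subrK.
have [i0 [j0 [i0m j0m hi0 hj0]]] := crossing_cell m0.
have sq i j : (i < 3 * m)%N -> (j < 3 * m)%N ->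
    square (l i j) (l i.+1 j) (l i j.+1) (l i.+1 j.+1) = (i == i0) && (j == j0).
  move=> i3 j3; pose e := (i %/ m)%N; pose e' := (j %/ m)%N.
  have e3 : (e < 3)%N by rewrite ltn_divLR.
  have e3' : (e' < 3)%N by rewrite ltn_divLR.
  have ei : (e * m <= i < e.+1 * m)%N by rewrite leq_divM ltn_ceil.
  have ej : (e' * m <= j < e'.+1 * m)%N by rewrite leq_divM ltn_ceil.
  have r1 : 0 <= r i e <= 1 by apply: r01; case/andP: ei => u v; rewrite ?(ltnW v) ?v ?u ?(leqW u).
  have r2 : 0 <= r i.+1 e <= 1 by apply: r01; case/andP: ei => u v; rewrite ?(ltnW v) ?v ?u ?(leqW u).
  have r1' : 0 <= r j e' <= 1 by apply: r01; case/andP: ej => u v; rewrite ?(ltnW v) ?v ?u ?(leqW u).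
  have r2' : 0 <= r j.+1 e' <= 1 by apply: r01; case/andP: ej => u v; rewrite ?(ltnW v) ?v ?u ?(leqW u).
  have [/eqP[e0 e0']|ee] := boolP ((e, e') == (0, 0)%N); last first.
    have [k k3 H] := hopf_label_missing e3 e3' ee.
    rewrite (square_missing k3); last first.
      by rewrite !(lE _ _ e e') !inE !negb_or ![k == _]eq_sym !H.
    apply/esym/negbTE; apply: contraNN ee => /andP[/eqP ii /eqP jj].
    by rewrite /e /e' ii jj !divn_small.
  rewrite e0 e0' in ei ej r1 r2 r1' r2'.
  have labE u v : 0 <= r u 0%N <= 1 -> 0 <= r v 0%N <= 1 -> l u v =
      if (m < 2 * u)%N then 1%N else if (5 * v < 4 * m)%N then 2%N else 3%N.
    move=> ru rv; rewrite (lE _ _ 0%N 0%N) hopf_label00 // /r !subr0 !mulrA.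
    rewrite ltr_pdivlMr ?ltr0n // ltr_pdivrMr ?ltr0n // mul1r.
    by rewrite -(natrM _ 2) -(natrM _ 5) -(natrM _ 4) !ltr_nat.
  by rewrite !labE //; exact: crossing_square.
have i03 : (i0 < 3 * m)%N by apply: leq_trans i0m _; rewrite leq_pmull.
have j03 : (j0 < 3 * m)%N by apply: leq_trans j0m _; rewrite leq_pmull.
rewrite /degree_mod2 -/l /layer_count big_mkord (bigD1 (Ordinal i03)) //=.
rewrite big_mkord (bigD1 (Ordinal j03)) //= sq // !eqxx /=.
rewrite big1 => [|j jj]; last first.
  by rewrite sq // eqxx /=; apply/negbTE; apply: contraNN jj => /eqP e; apply/eqP/val_inj.
rewrite big1 // => i ii; rewrite big_mkord big1 // => j _; rewrite sq //.
rewrite (_ : (val i == i0) = false) //.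
by apply/negbTE; apply: contraNN ii => /eqP e; apply/eqP/val_inj.
Qed.

End Example.

(** * The boundary polygons as a numbered link *)

Section ExampleLinks.
Variable R : realType.

Notation P := (points R coords).
Notation F := (surface_of faces).

Lemma boundary_vertex9 k m : (k < 3)%N -> (m < 3)%N -> (boundary_vertex k m < 9)%N.
Proof. by case: k => [|[|[|k]]] //; case: m => [|[|[|m]]]. Qed.

Lemma boundary_vertex_inj k m k' m' : (k < 3)%N -> (m < 3)%N -> (k' < 3)%N -> (m' < 3)%N ->
  boundary_vertex k m = boundary_vertex k' m' -> k = k' /\ m = m'.
Proof.
by case: k => [|[|[|k]]] //; case: m => [|[|[|m]]] //;
   case: k' => [|[|[|k']]] //; case: m' => [|[|[|m']]].
Qed.

Lemma next3_lt m : (next3 m < 3)%N. Proof. exact: ltn_pmod. Qed.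

Definition corner (k m : nat) : 'I_9 := inord (boundary_vertex k m).

Lemma val_corner k m : (k < 3)%N -> (m < 3)%N -> val (corner k m) = boundary_vertex k m.
Proof. by move=> k3 m3; rewrite /corner /= inordK // boundary_vertex9. Qed.

Lemma corner_inj k m k' m' : (k < 3)%N -> (m < 3)%N -> (k' < 3)%N -> (m' < 3)%N ->
  corner k m = corner k' m' -> k = k' /\ m = m'.
Proof.
by move=> *; apply: boundary_vertex_inj => //; rewrite -!val_corner //; congr val.
Qed.

(** The polygons lifted to the realization of the surface, so that its embeddedness makes them
    simple and disjoint. *)
Definition boundary_point (k m : nat) (r : R) : 'rV[R]_9 :=
  (1 - r) *: delta_mx 0 (corner k m) + r *: delta_mx 0 (corner k (next3 m)).

Lemma boundary_pointE k m r (x : 'I_9) : boundary_point k m r 0 x =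
  (1 - r) * (x == corner k m)%:R + r * (x == corner k (next3 m))%:R.
Proof. by rewrite !mxE. Qed.

Lemma curve_boundary_point k m r : (k < 3)%N -> (m < 3)%N -> 0 <= r <= 1 ->
  curve (polygon R k) (m%:R + r) = boundary_point k m r *m P.
Proof.
move=> k3 m3 r01; rewrite curve_polygon // mulmxDl -!scalemxAl -!rowE !row_points.
by rewrite !val_corner // next3_lt.
Qed.

Lemma boundary_edges_checked : all (fun k => all (fun m =>
  ((boundary_vertex k m, boundary_vertex k (next3 m)) \in boundary_sides faces))
  (iota 0 3)) (iota 0 3).
Proof. by vm_compute. Qed.

Lemma boundary_edge_corner k m : (k < 3)%N -> (m < 3)%N ->
  boundary_edge F (corner k m, corner k (next3 m)).
Proof.
move=> k3 m3; apply/(boundary_edgeP faces9); rewrite /= !val_corner ?next3_lt //.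
have kI : k \in iota 0 3 by rewrite mem_iota.
have mI : m \in iota 0 3 by rewrite mem_iota.
exact: (allP (allP boundary_edges_checked _ kI) _ mI).
Qed.

Lemma boundary_point_realization k m r : (k < 3)%N -> (m < 3)%N -> 0 <= r <= 1 ->
  realization F (boundary_point k m r).
Proof.
move=> k3 m3 r01; split.
- move=> x; rewrite boundary_pointE; do 2 case: (_ == _); rewrite ?mulr1 ?mulr0; lra.
- under eq_bigr do rewrite boundary_pointE.
  rewrite big_split /= -!mulr_sumr.
  have one (y : 'I_9) : \sum_(x < 9) (x == y)%:R = 1 :> R.
    by rewrite (bigD1 y) //= eqxx big1 ?addr0 // => x /negbTE ->.
  by rewrite !one; lra.
- have [[f fF ef] _] := boundary_edge_corner k3 m3; exists f => // x.
  rewrite mem_sides in ef; rewrite boundary_pointE mem_corners.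
  have : (val (corner k m) \in tri_corners (code f)) && (val (corner k (next3 m)) \in tri_corners (code f)).
    move: ef; rewrite /tri_sides /tri_corners !inE !xpair_eqE.
    by case/or3P=> /andP[/eqP <- /eqP <-]; rewrite !eqxx !orbT.
  move=> /andP[h1 h2]; have [-> //|n1] := eqVneq x (corner k m).
  have [-> //|n2] := eqVneq x (corner k (next3 m)).
  by rewrite !mulr0 addr0 eqxx.
Qed.

Lemma boundary_point_inj k m r k' m' r' : (k < 3)%N -> (m < 3)%N -> (k' < 3)%N -> (m' < 3)%N ->
  0 <= r < 1 -> 0 <= r' < 1 -> boundary_point k m r = boundary_point k' m' r' ->
  [/\ k = k', m = m' & r = r'].
Proof.
move=> k3 m3 k3' m3' r01 r01' e.
have next_neq i : (i < 3)%N -> i <> next3 i by case: i => [|[|[|i]]].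
have next_neq2 i j : (i < 3)%N -> (j < 3)%N -> i = next3 j -> j <> next3 i.
  by case: i => [|[|[|i]]] //; case: j => [|[|[|j]]].
have cn i j : (i < 3)%N -> (j < 3)%N -> (corner i j == corner i (next3 j)) = false.
  move=> i3 j3; apply/negP => /eqP /(corner_inj i3 j3 i3 (next3_lt j))[_]; exact: next_neq.
have E x : (1 - r) * (x == corner k m)%:R + r * (x == corner k (next3 m))%:R =
    (1 - r') * (x == corner k' m')%:R + r' * (x == corner k' (next3 m'))%:R.
  by rewrite -!boundary_pointE e.
have [a|na] := eqVneq (corner k m) (corner k' m').
  have [kk mm] := corner_inj k3 m3 k3' m3' a; subst k' m'; split => //.
  by have := E (corner k m); rewrite eqxx cn // !(mulr0, mulr1); lra.
have [b|nb] := eqVneq (corner k m) (corner k' (next3 m')).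
  have [kk mm] := corner_inj k3 m3 k3' (next3_lt _) b; subst k'.
  have [c|nc] := eqVneq (corner k m') (corner k (next3 m)).
    have [_ mm'] := corner_inj k3 m3' k3 (next3_lt _) c.
    by case: (next_neq2 _ _ m3 m3' mm mm').
  have := E (corner k m'); rewrite eqxx cn // [_ == corner k m]eq_sym (negbTE na) (negbTE nc) !(mulr0, mulr1); lra.
by have := E (corner k m); rewrite eqxx cn // (negbTE na) (negbTE nb) !(mulr0, mulr1); lra.
Qed.

Lemma unit_parameter (s : R) : 0 <= s < 3 -> exists m r, [/\ (m < 3)%N, 0 <= r < 1 & s = m%:R + r].
Proof.
move=> s3; have [s1|s1] := ltP s 1; first by exists 0%N, s; split => //; lra.
have [s2|s2] := ltP s 2; first by exists 1%N, (s - 1); split => //; lra.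
by exists 2%N, (s - 2); split => //; lra.
Qed.

Variable order : seq nat.
Hypothesis orderP : perm_eq order [:: 0; 1; 2]%N.

Definition numbered_polygon (i : 'I_3) : seq 'rV[R]_3 := polygon R (nth 0%N order i).

Lemma order_lt (i : 'I_3) : (nth 0%N order i < 3)%N.
Proof.
have : nth 0%N order i \in order by rewrite mem_nth // (perm_size orderP).
by rewrite (perm_mem orderP) !inE => /or3P[] /eqP ->.
Qed.

Lemma numbered_polygon_link : is_link numbered_polygon.
Proof.
split=> [i|i j s t]; rewrite /numbered_polygon ?size_polygon ?order_lt //.
move=> /unit_parameter[m [r [m3 r01 ->]]] /unit_parameter[m' [r' [m3' r01' ->]]].
have le1 (x : R) : 0 <= x < 1 -> 0 <= x <= 1 by lra.
rewrite !curve_boundary_point ?order_lt ?le1 // => e.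
have := surface_embedded (boundary_point_realization (order_lt i) m3 (le1 _ r01))
  (boundary_point_realization (order_lt j) m3' (le1 _ r01')) e.
move=> /boundary_point_inj [] // => [||ij mm rr]; rewrite ?order_lt //.
split; last by rewrite mm rr.
have uo : uniq order by rewrite (perm_uniq orderP).
have so : size order = 3%N := perm_size orderP.
by apply/val_inj; apply: (uniqP 0%N uo); rewrite -?topredE /= ?so.
Qed.

Definition numbered_link : link R 3 := Link numbered_polygon_link.

(** [has_boundary] quantifies over the components, so the numbering affects only which index,
    [index k order], serves as witness. *)
Lemma numbered_boundary : has_boundary P F numbered_link.
Proof.
move=> p q; split.
- case=> [[x y] [/(boundary_edgeP faces9) /= exy <- <-]].
  rewrite (perm_mem faces_boundary) in exy.
  have [k [m [k3 m3 [xE yE]]]] : exists k m, [/\ (k < 3)%N, (m < 3)%N &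
      val x = boundary_vertex k m /\ val y = boundary_vertex k (next3 m)].
    have H k m : (k < 3)%N -> (m < 3)%N ->
        (val x, val y) = (boundary_vertex k m, boundary_vertex k (next3 m)) ->
        exists k m, [/\ (k < 3)%N, (m < 3)%N &
          val x = boundary_vertex k m /\ val y = boundary_vertex k (next3 m)].
      by move=> k3 m3 [e1 e2]; exists k, m.
    move: exy; rewrite !inE => /or3P[/eqP e|/eqP e|]; [exact: (H 0%N 0%N)|exact: (H 0%N 1%N)|].
    move=> /or3P[/eqP e|/eqP e|]; [exact: (H 0%N 2%N)|exact: (H 1%N 0%N)|].
    move=> /or3P[/eqP e|/eqP e|]; [exact: (H 1%N 1%N)|exact: (H 1%N 2%N)|].
    move=> /or3P[] /eqP e; [exact: (H 2%N 0%N)|exact: (H 2%N 1%N)|exact: (H 2%N 2%N)].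
  have kO : k \in order.
    by rewrite (perm_mem orderP); case: k k3 {xE yE} => [|[|[|k]]].
  have i3 : (index k order < 3)%N by rewrite -[3%N](perm_size orderP) index_mem.
  exists (Ordinal i3), m%:Z; rewrite /= /numbered_polygon /= nth_index //.
  by rewrite vertex_polygon // vertex_polygonS // !row_points -xE -yE.
- case=> i [k [<- <-]]; rewrite /= /numbered_polygon; set c := nth 0%N order i.
  have c3 : (c < 3)%N := order_lt i.
  pose m := `|(k %% 3)%Z|%N.
  have mE : m%:Z = (k %% 3)%Z by rewrite /m gez0_abs // modz_ge0.
  have m3 : (m < 3)%N by rewrite -ltz_nat mE ltz_pmod.
  have kE : k = m%:Z + (k %/ 3)%Z * (size (polygon R c))%:Z.
    by rewrite size_polygon // mE addrC -divz_eq.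
  exists (corner c m, corner c (next3 m)); split; first exact: boundary_edge_corner.
  + by rewrite kE vertexD vertex_polygon // row_points val_corner.
  + rewrite kE addrAC vertexD vertex_polygonS // row_points.
    by rewrite (val_corner c3 (next3_lt _)).
Qed.

Lemma isotopic_refl n (L : link R n) : isotopic L L.
Proof.
exists (fun _ x => x); split => //.
- by apply: continuous_subspaceT; exact: continuous_snd.
- move=> t _; exists id => //; exact: continuous_identity.
- move=> i; exists id; split => //; exact: continuous_identity.
Qed.

Definition linking_sum (c d : 'M[int]_9) : int :=
  \sum_(x < 9) \sum_(x' < 9 | (x < x')%N) \sum_(y < 9) \sum_(y' < 9 | (y < y')%N)
    c x x' * d y y' * over_crossing (vec R view) (row x P) (row x' P)
      (row y (points R pushed_coords)) (row y' (points R pushed_coords)).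

(** The entries are left as sums; what matters is that they do not depend on [order]. *)
Lemma numbered_seifert_matrix : seifert_matrix numbered_link
  (\matrix_(i, j) linking_sum (H1_cycle i) (H1_cycle j)).
Proof.
exists numbered_link, 9%N, P, (points R pushed_coords), F, H1_cycle; split.
- exact: isotopic_refl.
- split; [exact: oriented_surface_of faces9 faces_oriented
    |exact: connected_surface_of faces9 _ faces_connected
    |exact: surface_embedded|exact: numbered_boundary].
- exact: surface_H1_basis.
- exact: surface_pushoff.
- move=> i j; rewrite mxE; exists (vec R view) => //.
  have diag k x : H1_cycle k x x = 0.
    by have [ac _ _] := H1_cycle_is_cycle k; have := ac x x; lia.
  by apply: view_regular => //; exact: generic_view.
Qed.

End ExampleLinks.

Lemma doubled_delta_related_same_degree (R : realType) (n : nat) (L L' : link R n) (i j : 'I_n) :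
  i != j -> doubled_delta_related L L' ->
  same_degree (curve_difference (L i) (L j)) (curve_difference (L' i) (L' j)).
Proof.
move=> ij; elim=> {L L'} [L L' [iso|dd]|L|L L' _|L1 L2 L3 _ H _ H'].
- exact: isotopic_same_degree.
- exact: doubled_delta_same_degree.
- by exists 0%N.
- exact: same_degree_sym.
- exact: same_degree_trans H H'.
Qed.

(* The first curve lies in the plane y = 0 and the third one in the half-space
   y < 0, so that their difference contracts to a constant. *)
Lemma split_degree (R : realType) : exists M, forall n, (M <= n)%N ->
  degree_mod2 n (curve_difference (polygon R 0) (polygon R 2)) = false.
Proof.
have [M H] : same_degree (curve_difference (polygon R 0) (polygon R 2)) (fun _ _ => pt3 0 1 0).
  have c0 := @curve_continuous _ (polygon R 0); have c2 := @curve_continuous _ (polygon R 2).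
  apply: (@homotopic_same_degree _ (fun t a b =>
    (1 - t) *: (curve (polygon R 0) (3%:R * a) - curve (polygon R 2) (3%:R * b)) + t *: pt3 0 1 0)).
  - by solve_continuity.
  - move=> t a b t01.
    have yE (k : nat) (s : R) : (k < 3)%N -> exists m r, [/\ (m < 3)%N, 0 <= r < 1 &
        curve (polygon R k) s 0 1 =
          (1 - r) * vec R (z3 coords (boundary_vertex k m)) 0 1 +
          r * vec R (z3 coords (boundary_vertex k (next3 m))) 0 1].
      move=> k3; have s3 := size_polygon R k3.
      have [u + [m _ ->]] := curve_reduce (K := polygon R k) s ltac:(by rewrite s3).
      rewrite s3 => /unit_parameter[i [r [i3 r01 ->]]]; exists i, r; split=> //.
      by rewrite curve_polygon ?mxE //; lra.
    have yA s : curve (polygon R 0) s 0 1 = 0.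
      have [m [r [m3 r01 ->]]] := yE 0%N s isT.
      by case: m m3 => [|[|[|m]]] // _; rewrite /= !vec_coords !mxE /=; lra.
    have yH s : curve (polygon R 2) s 0 1 < 0.
      have [m [r [m3 r01 ->]]] := yE 2%N s isT.
      by case: m m3 => [|[|[|m]]] // _; rewrite /= !vec_coords !mxE /=; lra.
    move: (yA (3%:R * a)) (yH (3%:R * b)).
    move: (curve _ _) (curve _ _) => p q p1 q1.
    by apply/eqP => /rowP /(_ 1); rewrite !mxE /= p1; nra.
  - move=> t a b; rewrite !mulrDr !mulr1.
    have shift k z : (k < 3)%N -> curve (polygon R k) (z + 3%:R) = curve (polygon R k) z.
      by move=> k3; have := curveD (polygon R k) z 1; rewrite mul1r size_polygon.
    by rewrite !shift.
  - by move=> a b; rewrite subr0 scale1r scale0r addr0.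
  - by move=> a b; rewrite subrr scale0r scale1r add0r.
exists M => n /H ->; rewrite /degree_mod2 /layer_count big1 // => i _; rewrite big1 // => j _.
by rewrite /square addbb.
Qed.

Theorem proposition4p1 (R : realType) :
  exists (n : nat) (L0 L1 : link R n),
    S_equivalent_links L0 L1 /\ ~ doubled_delta_related L0 L1.
Proof.
have o0 : perm_eq [:: 0; 2; 1]%N [:: 0; 1; 2]%N by [].
have o1 : perm_eq [:: 0; 1; 2]%N [:: 0; 1; 2]%N by [].
(* Components 0 and 1 are the split pair in the first link, whose second component is the hole, and
   the Hopf pair in the second link. *)
exists 3%N, (numbered_link R o0), (numbered_link R o1); split.
  eexists _, _, _, _; split; [exact: numbered_seifert_matrix|exact: numbered_seifert_matrix|].
  exact: S_refl.
move=> /(doubled_delta_related_same_degree (i := 0) (j := 1) isT) [M H].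
have [M' H'] := split_degree R.
(* The grid 3m is fine enough for both comparisons and is a multiple of the number of edges, as in
   [hopf_degree]. *)
pose m := (maxn M M').+1.
have Mm : (M <= 3 * m)%N by rewrite /m; lia.
have Mm' : (M' <= 3 * m)%N by rewrite /m; lia.
by have := hopf_degree R (m := m) isT; rewrite -H // H'.
Qed.
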